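(* Let $(\mathbb F,\star)\in\{(\mathbb C,* ),(\mathbb R,\top)\}$. Let $E,Q\in\mathbb F^{n,m}$ satisfy $E^\star Q=Q^\star E\ge0$ and let all left minimal indices of $\lambda E-Q$ be equal to zero (if there are any). Furthermore, let $L\in\mathbb F^{n,n}$ be such that $R:=-\frac12(L+L^\star)\ge0$. Then the following statements hold for the pencil $P(\lambda)=\lambda E-LQ$. (i) If $\lambda_0\in\mathbb C$ is an eigenvalue of $P(\lambda)$, then $\operatorname{Re}(\lambda_0)\le0$. (ii) If $\omega\in\mathbb R\setminus\{0\}$ and $\lambda_0=i\omega$ is an eigenvalue of $P(\lambda)$, then $\lambda_0$ is semisimple. Moreover, if the columns of $V\in\mathbb C^{m,k}$ form a basis of a regular deflating subspace of $P(\lambda)$ associated with $\lambda_0$, then $RQV=0$. (iii) The index of $P(\lambda)$ is at most two. (iv) All right minimal indices of $P(\lambda)$ are at most one (if there are any). (v) If in addition $\lambda E-Q$ is regular, then all left minimal indices of $P(\lambda)$ are zero (if there are any).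
   Context: $*$ is conjugate transpose, $\top$ is transpose; $W\ge0$ means Hermitian (real symmetric) positive semidefinite. A pencil is regular if it is square and its determinant is not identically zero. Every pencil $\lambda E-A$ with $E,A\in\mathbb C^{n,m}$ is equivalent (under $(\lambda E-A)\mapsto S(\lambda E-A)T$, $S,T$ nonsingular) to its Kronecker canonical form, block diagonal with blocks: $\mathcal L_\epsilon=\lambda[I_\epsilon\ 0]-[0\ I_\epsilon]$ of size $\epsilon\times(\epsilon+1)$ (the numbers $\epsilon\ge0$ are the right minimal indices); $\mathcal L_\eta^\top$ of size $(\eta+1)\times\eta$ (the numbers $\eta\ge0$ are the left minimal indices); Jordan blocks $\lambda I_\rho-J_\rho(\lambda_j)$ (the $\lambda_j\in\mathbb C$ are the finite eigenvalues); and blocks $\lambda J_\sigma(0)-I_\sigma$ (eigenvalue $\infty$). The index is the size of the largest block associated with $\infty$ (zero if there are none). An eigenvalue is semisimple if all its blocks have size one; its algebraic multiplicity is the sum of the sizes of its blocks. Let $\lambda_0\in\mathbb C$ be an eigenvalue of $\lambda E-A$ of algebraic multiplicity $k$. A $k$-dimensional subspace $\mathcal X\subseteq\mathbb C^m$ is a regular deflating subspace associated with $\lambda_0$ if there exist nonsingular $X\in\mathbb C^{m,m}$, $Y\in\mathbb C^{n,n}$ such that the first $k$ columns of $X$ span $\mathcal X$ and $Y(\lambda E-A)X=\begin{bmatrix}R_0(\lambda)&0\\0&\widetilde P(\lambda)\end{bmatrix}$, where $R_0(\lambda)$ is a regular $k\times k$ pencil whose only eigenvalue is $\lambda_0$,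 and $\widetilde P(\lambda)$ does not have $\lambda_0$ as an eigenvalue. *)

(* Defs.v *)
From HB Require Import structures.
From mathcomp Require Import all_boot all_order all_algebra.
From mathcomp Require Import complex boolp classical_sets reals.

Set Implicit Arguments.
Unset Strict Implicit.
Unset Printing Implicit Defensive.

Import Order.TTheory GRing.Theory Num.Theory.
Local Open Scope ring_scope.
Local Open Scope complex_scope.

(* A pencil \lambda E - A is given by its pair of coefficients E and A. *)

(* [RightBlock eps] is L_eps, of size eps x (eps + 1); [LeftBlock eta] is the
   transpose of L_eta; [JordanBlock lam rho] is \lambda I - J_rho(lam);
   [InfBlock sigma] is \lambda J_sigma(0) - I. *)
Variant kblock (C : Type) :=
  | RightBlock of nat
  | LeftBlock of nat
  | JordanBlock of C & nat
  | InfBlock of nat.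

Arguments RightBlock {C}.
Arguments LeftBlock {C}.
Arguments InfBlock {C}.

Section KblockChoice.
Variable C : choiceType.

Definition kblock_code (b : kblock C) : (nat + nat) + (C * nat + nat) :=
  match b with
  | RightBlock e => inl (inl e)
  | LeftBlock e => inl (inr e)
  | JordanBlock c r => inr (inl (c, r))
  | InfBlock s => inr (inr s)
  end.

Definition kblock_decode (x : (nat + nat) + (C * nat + nat)) : kblock C :=
  match x with
  | inl (inl e) => RightBlock e
  | inl (inr e) => LeftBlock e
  | inr (inl (c, r)) => JordanBlock c r
  | inr (inr s) => InfBlock s
  end.

Lemma kblock_codeK : cancel kblock_code kblock_decode.
Proof. by case. Qed.

HB.instance Definition _ := Choice.copy (kblock C) (can_type kblock_codeK).

End KblockChoice.

Section Kronecker.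
Variable C : closedFieldType.
Implicit Types (b : kblock C) (s : seq (kblock C)) (lam : C).

Definition block_rows b : nat :=
  match b with
  | RightBlock e => e
  | LeftBlock e => e.+1
  | JordanBlock _ r => r
  | InfBlock r => r
  end.

Definition block_cols b : nat :=
  match b with
  | RightBlock e => e.+1
  | LeftBlock e => e
  | JordanBlock _ r => r
  | InfBlock r => r
  end.

(* Jordan and infinite blocks of size zero are excluded, as they would
   create spurious eigenvalues; L_0 and its transpose are allowed, and are the
   0 x 1 and 1 x 0 blocks. *)
Definition block_ok b : bool :=
  match b with
  | JordanBlock _ r | InfBlock r => (0 < r)%N
  | RightBlock _ | LeftBlock _ => true
  end.

Definition jordan_mx r lam : 'M[C]_r :=
  \matrix_(i, j) (lam *+ (i == j) + (i.+1 == j :> nat)%:R).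

(* The matrices [I 0] and [0 I] of size e x (e + 1). *)
Definition id_zero_mx e : 'M[C]_(e, e.+1) :=
  \matrix_(i, j) (i == j :> nat)%:R.
Definition zero_id_mx e : 'M[C]_(e, e.+1) :=
  \matrix_(i, j) (i.+1 == j :> nat)%:R.

Definition block_E b : 'M[C]_(block_rows b, block_cols b) :=
  match b with
  | RightBlock e => id_zero_mx e
  | LeftBlock e => (id_zero_mx e)^T
  | JordanBlock _ r => 1%:M
  | InfBlock r => jordan_mx r 0
  end.

Definition block_A b : 'M[C]_(block_rows b, block_cols b) :=
  match b with
  | RightBlock e => zero_id_mx e
  | LeftBlock e => (zero_id_mx e)^T
  | JordanBlock lam r => jordan_mx r lam
  | InfBlock r => 1%:M
  end.

Definition form_rows s : nat := sumn [seq block_rows b | b <- s].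
Definition form_cols s : nat := sumn [seq block_cols b | b <- s].

Fixpoint blockdiag (M : forall b, 'M[C]_(block_rows b, block_cols b)) s :
    'M[C]_(form_rows s, form_cols s) :=
  match s with
  | [::] => 0
  | b :: s' => block_mx (M b) 0 0 (blockdiag M s')
  end.

Definition is_kronecker_form n m (E A : 'M[C]_(n, m)) s : Prop :=
  all block_ok s /\
  exists (en : n = form_rows s) (em : m = form_cols s)
         (S : 'M[C]_n) (T : 'M[C]_m),
    [/\ S \in unitmx, T \in unitmx,
        castmx (en, em) (S *m E *m T) = blockdiag block_E s &
        castmx (en, em) (S *m A *m T) = blockdiag block_A s].

(* Every pencil over an algebraically closed field has a Kronecker form, which
   is unique up to the order of the blocks; the default value [::] is thus never
   used, and the notions below do not depend on the form that is chosen. *)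
Definition kronecker_form n m (E A : 'M[C]_(n, m)) : seq (kblock C) :=
  xget [::] [set s | is_kronecker_form E A s].

Section Invariants.
Variables n m : nat.
Implicit Types E A : 'M[C]_(n, m).

Definition right_minimal_index E A (eps : nat) : Prop :=
  RightBlock eps \in kronecker_form E A.

Definition left_minimal_index E A (eta : nat) : Prop :=
  LeftBlock eta \in kronecker_form E A.

Definition finite_eigenvalue E A lam : Prop :=
  exists r, JordanBlock lam r \in kronecker_form E A.

Definition infinite_eigenvalue E A : Prop :=
  exists r, InfBlock r \in kronecker_form E A.

Definition pencil_index E A : nat :=
  \max_(b <- kronecker_form E A) (if b is InfBlock r then r else 0%N).

Definition algebraic_multiplicity E A lam : nat :=
  \sum_(b <- kronecker_form E A)
     (if b is JordanBlock mu r then if mu == lam then r else 0%N else 0%N).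

Definition semisimple_eigenvalue E A lam : Prop :=
  forall r, JordanBlock lam r \in kronecker_form E A -> r = 1%N.

Definition pencil_mx E A : 'M[{poly C}]_(n, m) :=
  'X *: map_mx polyC E - map_mx polyC A.

Definition regular_pencil E A : Prop :=
  exists e : m = n, \det (castmx (erefl n, e) (pencil_mx E A)) != 0.

End Invariants.

Definition columns m k (V : 'M[C]_(m, k)) : k.-tuple 'cV[C]_m :=
  [tuple col j V | j < k].

Definition regular_deflating_subspace n m (E A : 'M[C]_(n, m)) lam
    (U : {vspace 'cV[C]_m}) : Prop :=
  let k := algebraic_multiplicity E A lam in
  [/\ finite_eigenvalue E A lam, \dim U = k &
    exists (p q : nat) (en : n = (k + p)%N) (em : m = (k + q)%N)
           (X : 'M[C]_m) (Y : 'M[C]_n)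
           (E0 A0 : 'M[C]_k) (E1 A1 : 'M[C]_(p, q)),
    [/\ X \in unitmx /\ Y \in unitmx,
        U = <<columns (lsubmx (castmx (erefl m, em) X))>>%VS,
        castmx (en, em) (Y *m E *m X) = block_mx E0 0 0 E1 /\
          castmx (en, em) (Y *m A *m X) = block_mx A0 0 0 A1,
        [/\ regular_pencil E0 A0,
            forall mu, finite_eigenvalue E0 A0 mu <-> mu = lam &
            ~ infinite_eigenvalue E0 A0] &
        ~ finite_eigenvalue E1 A1 lam]].

End Kronecker.

Variant ground := GroundComplex | GroundReal.

Section Ground.
Variables (R : realType) (K : ground).

(* The pairs (C, conjugate transpose) and (R, transpose) are treated uniformly:
   K selects one of them. The matches below are annotated because ground_field
   does not reduce while K is a variable. *)
Definition ground_field : numFieldType :=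
  match K with GroundComplex => R[i] | GroundReal => R end.

Definition ground_conj : ground_field -> ground_field :=
  match K return
    (match K with GroundComplex => R[i] : numFieldType | GroundReal => R end ->
     match K with GroundComplex => R[i] : numFieldType | GroundReal => R end)
  with GroundComplex => @conjc R | GroundReal => id end.

Definition to_complex : ground_field -> R[i] :=
  match K return
    (match K with GroundComplex => R[i] : numFieldType | GroundReal => R end ->
     R[i])
  with GroundComplex => id | GroundReal => fun x => x%:C end.

Definition star n m (M : 'M[ground_field]_(n, m)) : 'M[ground_field]_(m, n) :=
  map_mx ground_conj M^T.

Definition complexify n m (M : 'M[ground_field]_(n, m)) : 'M[R[i]]_(n, m) :=
  map_mx to_complex M.

(* In R[i], 0 <= z means that z is real and nonnegative. *)
Definition psd m (W : 'M[ground_field]_m) : Prop :=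
  star W = W /\ forall x : 'cV[ground_field]_m, 0 <= (star x *m W *m x) 0 0.

End Ground.

(* Main.v *)
Require Import Defs.
From mathcomp Require Import all_boot all_order all_algebra.
From mathcomp Require Import complex boolp classical_sets reals.
From mathcomp Require Import ring.
From mathcomp Require Import spectral.

Set Implicit Arguments.
Unset Strict Implicit.
Unset Printing Implicit Defensive.

Import Order.TTheory GRing.Theory Num.Theory.
Local Open Scope ring_scope.
Local Open Scope sesquilinear_scope.

(** The pencil [(E, Q)] is Lagrangian: [E^* Q] is Hermitian.  Hence the shift
    [G = E - i Q] satisfies [G^* G = E^* E + Q^* Q], and its kernel is the common
    kernel of [E] and [Q].  If all left minimal indices of [(E, Q)] vanish, the
    image of [Q] lies in that of [G] ([lagrangian_shift_image]).  This yields
    [isotropic_split]: a vector [v] of zero energy [v^* Q^* E v] is a sum [a + b]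
    with [E a = 0] and [Q b = 0].

    For [P = z E - L Q], pairing [L Q v = lam E v] with [Q v] gives
    [(Q v)^* L (Q v) = lam (v^* Q^* E v)], whose real part is minus the dissipated
    power.  If [Re lam > 0] the energy of [v] must vanish; if [lam] is imaginary the
    dissipated power vanishes, and a second vector in the Jordan chain again makes
    the energy of [v] vanish.  The splitting [v = a + b] then turns [v] into a value
    of the polynomial null vector [z a + lam b] of [P], which is impossible for
    an eigenvector from the regular part of [P] unless [lam = 0].  At infinity, and
    for right Kronecker chains read backwards, three consecutive vectors [x0, x1,
    x2] make the energy of [x1] vanish, and the part [b] of [x1] closes the
    chain after two steps ([infinite_chain_closes]).  For a regular [(E, Q)], the
    adjoint relations give the dual statement [left_chain_trivial].

    Kronecker forms enter through direct summands ([summand]): a block of the form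
    of [P] provides a chain of vectors together with a projection, and so
    does every block of the pencil carried by a deflating subspace.

    To use the hypothesis on [(E, Q)], a Kronecker form of this pencil must be shown
    to exist.  A vector [v] with [E v] and [Q v] dependent splits off by
    orthogonality ([lagrangian_partial_form]).  When there is none left,
    only chains of left type remain, and [injective_form] finds them by
    induction on the pencil formed by [E^-1 Q] on the vectors that [Q] maps into the
    image of [E]. *)

(** * Conjugate transposes and semidefinite forms *)

Section ConjugateTranspose.
Variable C : numClosedFieldType.

Lemma trmxC_mul m n p (A : 'M[C]_(m, n)) (B : 'M[C]_(n, p)) :
  (A *m B)^t* = B^t* *m A^t*.
Proof. by rewrite trmx_mul map_mxM. Qed.

Lemma trmxCD m n (A B : 'M[C]_(m, n)) : (A + B)^t* = A^t* + B^t*.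
Proof. by rewrite linearD map_mxD. Qed.

Lemma trmxCN m n (A : 'M[C]_(m, n)) : (- A)^t* = - A^t*.
Proof. by rewrite linearN map_mxN. Qed.

Lemma trmxCZ m n a (A : 'M[C]_(m, n)) : (a *: A)^t* = a^* *: A^t*.
Proof. by rewrite linearZ map_mxZ. Qed.

Lemma trmxC0 m n : (0 : 'M[C]_(m, n))^t* = 0.
Proof. by rewrite trmx0 map_mx0. Qed.

Lemma gram_eq0 m n (A : 'M[C]_(m, n)) : A^t* *m A = 0 -> A = 0.
Proof.
move=> /matrixP h; apply/matrixP=> i j; rewrite mxE.
have := h j j; rewrite !mxE => /eqP; rewrite psumr_eq0 => [/allP/(_ i)|k _].
  by rewrite mem_index_enum !mxE mulrC mul_conjC_eq0 => /(_ isT)/eqP.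
by rewrite !mxE mulrC mul_conjC_ge0.
Qed.

Lemma form_herm n k (W : 'M[C]_n) (x : 'M[C]_(n, k)) :
  W^t* = W -> (x^t* *m W *m x)^t* = x^t* *m W *m x.
Proof. by move=> hW; rewrite !trmxC_mul trmxCK hW mulmxA. Qed.

(** If [W x] were nonzero, moving [x] along [- W x] would make the form negative
    to first order. *)
Lemma psd_isotropic n (W : 'M[C]_n) (x : 'cV[C]_n) :
  W^t* = W -> (forall y : 'cV_n, 0 <= (y^t* *m W *m y) 0 0) ->
  x^t* *m W *m x = 0 -> W *m x = 0.
Proof.
move=> hW pW xWx; apply: gram_eq0.
set a := ((W *m x)^t* *m (W *m x)) 0 0.
suff a0 : a = 0 by apply/matrixP=> i j; rewrite !ord1 -/a a0 mxE.
have a_ge0 : 0 <= a.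
  by rewrite /a mxE sumr_ge0 // => k _; rewrite !mxE mulrC mul_conjC_ge0.
pose c := ((W *m x)^t* *m W *m (W *m x)) 0 0.
have c_ge0 : 0 <= c := pW _.
have c1_gt0 : 0 < c + 1 by rewrite ltr_wpDl.
pose t := a / (c + 1).
have t_ge0 : 0 <= t by rewrite divr_ge0 // ltW.
have := pW (x - t *: (W *m x)).
have -> : ((x - t *: (W *m x))^t* *m W *m (x - t *: (W *m x))) 0 0
    = t * (t * c - 2 * a).
  have tr : t^* = t by apply/CrealP/ger0_real.
  rewrite trmxCD trmxCN trmxCZ tr !mulmxDl !mulmxDr xWx.
  have e1 : x^t* *m W *m (- (t *: (W *m x))) = - t *: ((W *m x)^t* *m (W *m x)).
    by rewrite mulmxN -scalemxAr scaleNr trmxC_mul hW.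
  have e2 : (- (t *: (W *m x)^t*)) *m W *m x = - t *: ((W *m x)^t* *m (W *m x)).
    by rewrite !mulNmx -!scalemxAl scaleNr -mulmxA.
  rewrite e1 e2 mulmxN !mulNmx opprK -!scalemxAl -scalemxAr.
  have ij (A B : 'M[C]_1) : (A + B) 0 0 = A 0 0 + B 0 0 by rewrite mxE.
  have iz z (A : 'M[C]_1) : (z *: A) 0 0 = z * A 0 0 by rewrite mxE.
  have iN (A : 'M[C]_1) : (- A) 0 0 = - A 0 0 by rewrite mxE.
  rewrite add0r !(ij, iz, iN) -/a -/c.
  by rewrite /c; ring.
rewrite le_eqVlt in a_ge0; case/orP: a_ge0 => [/eqP<- //|a_gt0].
have t_gt0 : 0 < t by rewrite divr_gt0.
rewrite pmulr_rge0 // subr_ge0 => h.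
have : t * c <= a.
  by rewrite /t mulrAC ler_pdivrMr // ler_pM2l // lerDl.
move/(le_trans h); rewrite -[X in _ <= X]mul1r ler_pM2r // => /le_gtF.
by rewrite ltr1n.
Qed.

End ConjugateTranspose.

(** * Lagrangian pencils and dissipation *)

Section LagrangianPencil.
Variables (C : numClosedFieldType) (n m : nat) (E Q : 'M[C]_(n, m)).
Hypothesis EQ_sym : E^t* *m Q = Q^t* *m E.

Let G := E - 'i *: Q.

(** The cross terms cancel: the shift is imaginary and [E^* Q] is Hermitian. *)
Lemma gram_shift : G^t* *m G = E^t* *m E + Q^t* *m Q.
Proof.
rewrite /G trmxCD trmxCN trmxCZ conjCi scaleNr opprK mulmxDl !mulmxDr.
rewrite !mulmxN -!scalemxAr -!scalemxAl EQ_sym scalerA mulCii scaleN1r opprK.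
by rewrite addrACA [X in _ + X]addrC -addrA [X in _ + X]addrC subrK.
Qed.

Lemma ker_shift k (X : 'M[C]_(m, k)) : G *m X = 0 -> E *m X = 0 /\ Q *m X = 0.
Proof.
move=> GX.
have : (E *m X)^t* *m (E *m X) + (Q *m X)^t* *m (Q *m X) = 0.
  rewrite !trmxC_mul -!mulmxA -mulmxDr !mulmxA -mulmxDl -gram_shift.
  by rewrite -!mulmxA GX !mulmx0.
move=> h; suff EX : E *m X = 0.
  by split=> //; move: GX; rewrite mulmxBl EX sub0r -scalemxAl => /eqP;
    rewrite oppr_eq0 scaler_eq0 (negPf (neq0Ci _)) => /eqP.
apply/matrixP=> i j; rewrite [RHS]mxE.
move/matrixP/(_ j j): h; rewrite !mxE => /eqP.
have ge0 (A : 'M[C]_(n, k)) : 0 <= \sum_l (A^t*) j l * A l j.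
  by rewrite sumr_ge0 // => l _; rewrite !mxE mulrC mul_conjC_ge0.
rewrite paddr_eq0 // psumr_eq0 => [/andP[/allP/(_ i) h _]|l _].
  by move: h; rewrite mem_index_enum !mxE mulrC mul_conjC_eq0 => /(_ isT)/eqP.
by rewrite !mxE mulrC mul_conjC_ge0.
Qed.

(** [a^* E^* E a = i a^* E^* Q a] equates a real number with an imaginary one. *)
Lemma shift_isotropic k (a : 'M[C]_(m, k)) :
  E^t* *m (G *m a) = 0 -> E *m a = 0.
Proof.
move=> EGa; apply: gram_eq0.
pose A := (E *m a)^t* *m (E *m a); pose B := a^t* *m (E^t* *m Q) *m a.
have eAB : A = 'i *: B.
  have : a^t* *m (E^t* *m (G *m a)) = 0 by rewrite EGa mulmx0.
  rewrite /G mulmxBl !mulmxBr -!scalemxAl -!scalemxAr => /eqP; rewrite subr_eq0 => /eqP.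
  by rewrite /A /B trmxC_mul !mulmxA.
have hA : A^t* = A by rewrite /A trmxC_mul trmxCK.
have hB : B^t* = B by rewrite /B form_herm // trmxC_mul trmxCK EQ_sym.
have : A = - A by rewrite -{1}hA eAB trmxCZ hB conjCi scaleNr.
move/eqP; rewrite -subr_eq0 opprK -mulr2n -scaler_nat scaler_eq0 pnatr_eq0 /=.
by move/eqP.
Qed.

(* Equivalent to the absence of left Kronecker chains of positive length. *)
Hypothesis image_Q : forall v : 'cV[C]_m, exists a : 'cV[C]_m, G *m a = Q *m v.

(** Up to a change of bases [E] and [Q] are diagonal, and a vector of zero energy
    lives where one of the two entries vanishes; [a] is its part where [E] does.
    The shift finds [a] without diagonalizing. *)
Lemma isotropic_split (v : 'cV[C]_m) :
  E^t* *m (Q *m v) = 0 -> exists a : 'cV[C]_m, E *m a = 0 /\ Q *m a = Q *m v.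
Proof.
move=> EQv; have [a0 Ga0] := image_Q v; exists (- 'i *: a0).
have Ea : E *m (- 'i *: a0) = 0.
  by rewrite -scalemxAr shift_isotropic ?scaler0 // Ga0 EQv.
split=> //; rewrite -Ga0 mulmxBl -scalemxAl -scalemxAr scaleNr.
move/eqP: Ea; rewrite -scalemxAr scaler_eq0 oppr_eq0 (negPf (neq0Ci _)) /=.
by move/eqP=> ->; rewrite sub0r.
Qed.

Variable L : 'M[C]_n.
Let D := - 2^-1 *: (L + L^t*).
Hypothesis EQ_psd : forall x : 'cV[C]_m, 0 <= (x^t* *m (Q^t* *m E) *m x) 0 0.
Hypothesis D_psd : forall x : 'cV[C]_n, 0 <= (x^t* *m D *m x) 0 0.

Lemma D_herm : D^t* = D.
Proof.
rewrite /D trmxCZ trmxCD trmxCK rmorphN /= fmorphV /= conjC_nat.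
by rewrite [L^t* + _]addrC.
Qed.

Lemma supply_rate (x : 'cV[C]_n) :
  x^t* *m L *m x + (x^t* *m L *m x)^t* = - 2 *: (x^t* *m D *m x).
Proof.
rewrite !trmxC_mul trmxCK mulmxA -mulmxDl -mulmxDr /D.
by rewrite -scalemxAr -scalemxAl scalerA mulrNN divff ?pnatr_eq0 // scale1r.
Qed.

Lemma supply_rate_scalar (x : 'cV[C]_n) :
  let s := (x^t* *m L *m x) 0 0 in s + s^* = - 2 * (x^t* *m D *m x) 0 0.
Proof.
move: (supply_rate x); move: (_ *m L *m x) (_ *m D *m x) => A B.
by move/matrixP/(_ 0 0); rewrite !mxE.
Qed.

Lemma lossless (x : 'cV[C]_n) :
  x^t* *m L *m x + (x^t* *m L *m x)^t* = 0 ->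
  D *m x = 0 /\ L^t* *m x = - (L *m x).
Proof.
rewrite supply_rate => /eqP; rewrite scaler_eq0 oppr_eq0 pnatr_eq0 /= => /eqP h.
have Dx : D *m x = 0 := psd_isotropic D_herm D_psd h.
split=> //; move: Dx; rewrite -scalemxAl => /eqP.
rewrite scaler_eq0 oppr_eq0 invr_eq0 pnatr_eq0 /= mulmxDl addrC addr_eq0.
by move/eqP.
Qed.

Lemma storage_isotropic (x : 'cV[C]_m) :
  x^t* *m (Q^t* *m E) *m x = 0 -> E^t* *m (Q *m x) = 0.
Proof.
move=> h; rewrite mulmxA EQ_sym; apply: psd_isotropic h => //.
by rewrite trmxC_mul trmxCK EQ_sym.
Qed.

(** The power [(Q v)^* L (Q v) = lam ((Q v)^* E v)] has a nonpositive real part,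
    while the energy [(Q v)^* E v] is nonnegative. *)
Lemma unstable_isotropic lam (v : 'cV[C]_m) :
  L *m Q *m v = lam *: (E *m v) -> 0 < 'Re lam -> E^t* *m (Q *m v) = 0.
Proof.
move=> ev re; apply: storage_isotropic.
pose s := (v^t* *m (Q^t* *m E) *m v) 0 0.
have sE : v^t* *m (Q^t* *m E) *m v = s%:M by rewrite [LHS]mx11_scalar.
have hs : s^* = s by apply/CrealP/ger0_real/EQ_psd.
have s_ge0 : 0 <= s := EQ_psd v.
have e : (Q *m v)^t* *m L *m (Q *m v) = lam *: (v^t* *m (Q^t* *m E) *m v).
  by rewrite -mulmxA [L *m _]mulmxA ev -scalemxAr trmxC_mul !mulmxA.
have := supply_rate_scalar (Q *m v); rewrite /= e.
have -> : (lam *: (v^t* *m (Q^t* *m E) *m v)) 0 0 = lam * s by rewrite mxE.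
rewrite rmorphM /= hs -mulrDl => power.
have lam2 : lam + lam^* = 2 * 'Re lam.
  by rewrite ReE mulrC divfK ?pnatr_eq0.
have s0 : s = 0.
  apply: le_anti; rewrite s_ge0 andbT -(pmulr_rle0 _ re).
  rewrite -(@pmulr_rle0 _ 2) ?ltr0n // mulrA -lam2 power mulNr oppr_le0.
  by rewrite mulr_ge0 ?ler0n ?D_psd.
by rewrite sE s0 raddf0.
Qed.

(** The power of [Q v] is [lam] times a real energy, hence imaginary, and nothing
    is dissipated. *)
Lemma imaginary_lossless lam (v : 'cV[C]_m) :
  L *m Q *m v = lam *: (E *m v) -> lam^* = - lam ->
  D *m (Q *m v) = 0 /\ L^t* *m (Q *m v) = - (L *m (Q *m v)).
Proof.
move=> ev im; apply: lossless.
have -> : (Q *m v)^t* *m L *m (Q *m v) = lam *: (v^t* *m (Q^t* *m E) *m v).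
  by rewrite -mulmxA [L *m _]mulmxA ev -scalemxAr trmxC_mul !mulmxA.
rewrite trmxCZ form_herm; last by rewrite trmxC_mul trmxCK EQ_sym.
by rewrite im scaleNr subrr.
Qed.

(** For a Jordan chain on the imaginary axis, pairing its second relation with
    [Q v] leaves only the energy of [v]. *)
Lemma imaginary_chain_isotropic lam (v w : 'cV[C]_m) :
  L *m Q *m v = lam *: (E *m v) -> lam^* = - lam ->
  L *m Q *m w = lam *: (E *m w) + E *m v -> E^t* *m (Q *m v) = 0.
Proof.
move=> ev im ew; have [_ Lv] := imaginary_lossless ev im.
apply: storage_isotropic.
have : (Q *m v)^t* *m (L *m Q *m w) = (L^t* *m (Q *m v))^t* *m (Q *m w).
  by rewrite [in RHS]trmxC_mul trmxCK !mulmxA.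
rewrite Lv [L *m (Q *m v)]mulmxA ev ew trmxCN trmxCZ im scaleNr opprK mulmxDr.
rewrite -scalemxAr -scalemxAl !trmxC_mul -!mulmxA [Q^t* *m (E *m w)]mulmxA.
rewrite -EQ_sym -!mulmxA [X in X = _]addrC => /(canRL (addrK _)).
by rewrite subrr.
Qed.

(** At infinity: the first relation makes [Q x0] lossless, and then the energy of
    [x1] equals [- x0^* E^* Q x2 = 0].  So [x1] splits, and its part [b] with
    [Q b = 0] already closes the chain. *)
Lemma infinite_chain_closes (x0 x1 x2 : 'cV[C]_m) :
  E *m x0 = 0 -> E *m x1 = L *m Q *m x0 -> E *m x2 = L *m Q *m x1 ->
  exists b : 'cV[C]_m, Q *m b = 0 /\ E *m b = E *m x1.
Proof.
move=> Ex0 Ex1 Ex2.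
have x0E : x0^t* *m E^t* = 0 by rewrite -trmxC_mul Ex0 trmxC0.
have [_ Lx0] : D *m (Q *m x0) = 0 /\ L^t* *m (Q *m x0) = - (L *m (Q *m x0)).
  apply: lossless.
  suff -> : (Q *m x0)^t* *m L *m (Q *m x0) = 0 by rewrite trmxC0 addr0.
  rewrite -mulmxA [L *m _]mulmxA -Ex1 trmxC_mul -mulmxA [Q^t* *m _]mulmxA.
  by rewrite -EQ_sym !mulmxA x0E !mul0mx.
have [] := @isotropic_split x1.
  apply: storage_isotropic; rewrite -EQ_sym mulmxA -trmxC_mul Ex1.
  rewrite -[L *m Q *m x0]mulmxA -[L *m (Q *m x0)]opprK -Lx0 trmxCN.
  rewrite trmxC_mul trmxCK !mulNmx -!mulmxA [L *m (Q *m x1)]mulmxA -Ex2.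
  by rewrite trmxC_mul -mulmxA [Q^t* *m _]mulmxA -EQ_sym !mulmxA x0E !mul0mx oppr0.
move=> a [Ea Qa]; exists (x1 - a).
by rewrite !mulmxBr Ea Qa subrr subr0.
Qed.

End LagrangianPencil.

Section RegularLagrangianPencil.
Variables (C : numClosedFieldType) (n : nat) (E Q L : 'M[C]_n).
Hypothesis EQ_sym : E^t* *m Q = Q^t* *m E.
Hypothesis shift_unit : E - 'i *: Q \in unitmx.
Let D := - 2^-1 *: (L + L^t*).
Hypothesis EQ_psd : forall x : 'cV[C]_n, 0 <= (x^t* *m (Q^t* *m E) *m x) 0 0.
Hypothesis D_psd : forall x : 'cV[C]_n, 0 <= (x^t* *m D *m x) 0 0.

Let G := E - 'i *: Q.
Let H := E + 'i *: Q.

(** For [z = G^-1 y], [shift_isotropic] gives [E z = 0], which leaves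
    [y = - i Q z]. *)
Lemma ker_adj_in_image (y : 'cV[C]_n) :
  E^t* *m y = 0 -> exists z : 'cV[C]_n, E *m z = 0 /\ Q *m z = y.
Proof.
move=> Ey; pose z := invmx G *m y.
have Gz : G *m z = y by rewrite mulKVmx.
have Ez : E *m z = 0 by apply: (shift_isotropic EQ_sym); rewrite -/G Gz.
exists (- 'i *: z); rewrite -!scalemxAr Ez scaler0; split=> //.
by rewrite -Gz /G mulmxBl Ez sub0r -scalemxAl scaleNr.
Qed.

Lemma coshift_adj : H^t* = E^t* - 'i *: Q^t*.
Proof. by rewrite /H trmxCD trmxCZ conjCi scaleNr. Qed.

Lemma coshift_unit : H \in unitmx.
Proof.
have : H^t* *m H = G^t* *m G.
  rewrite gram_shift // coshift_adj /H mulmxBl !mulmxDr -!scalemxAr -!scalemxAl.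
  rewrite EQ_sym scalerA mulCii scaleN1r opprD opprK addrA.
  by rewrite -[_ + _ - _]addrA subrr addr0.
move=> hHG; have : H^t* *m H \in unitmx.
  by rewrite hHG unitmx_mul map_unitmx unitmx_tr shift_unit.
by rewrite unitmx_mul => /andP[].
Qed.

(** [Q^* G = H^* Q] moves the adjoint [Q^*] past the shift, so that
    [H^* w = Q^* (t - i w)] exhibits [w] in the image of [Q]. *)
Lemma image_of_adj_relation (w t : 'cV[C]_n) :
  E^t* *m w = Q^t* *m t -> exists u : 'cV[C]_n, Q *m u = w.
Proof.
move=> Ew; exists (invmx G *m (t - 'i *: w)).
have intertwine : Q^t* *m G = H^t* *m Q.
  by rewrite coshift_adj /G mulmxBr mulmxBl EQ_sym -scalemxAr -scalemxAl.
have Hu : H^t* \in unitmx by rewrite map_unitmx unitmx_tr coshift_unit.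
apply: (can_inj (mulKmx Hu)); rewrite [LHS]mulmxA -intertwine -mulmxA mulKVmx //.
by rewrite coshift_adj mulmxBr mulmxBl Ew -!scalemxAr -!scalemxAl.
Qed.

(** Writing [y = Q z] with [E z = 0] and [w = Q u], the vector [y] is lossless, and
    the energy of [u] is [- p^* E z = 0]. *)
Lemma left_chain_trivial (y w p : 'cV[C]_n) :
  E^t* *m y = 0 -> E^t* *m w = (L *m Q)^t* *m y ->
  E^t* *m p = (L *m Q)^t* *m w -> (L *m Q)^t* *m y = 0.
Proof.
move=> Ey Ew Ep; have [z [Ez Qz]] := ker_adj_in_image Ey.
have zE : z^t* *m E^t* = 0 by rewrite -trmxC_mul Ez trmxC0.
have zQw : z^t* *m (Q^t* *m (L^t* *m w)) = 0.
  by rewrite [Q^t* *m _]mulmxA -trmxC_mul -Ep mulmxA zE mul0mx.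
have [_ Ly] : D *m y = 0 /\ L^t* *m y = - (L *m y).
  apply: lossless => //.
  suff h : y^t* *m L^t* *m y = 0.
    have -> : y^t* *m L *m y = (y^t* *m L^t* *m y)^t*.
      by rewrite !trmxC_mul !trmxCK mulmxA.
    by rewrite h !trmxC0 addr0.
  rewrite -{1}Qz trmxC_mul -!mulmxA [Q^t* *m _]mulmxA -trmxC_mul -Ew mulmxA zE.
  by rewrite mul0mx.
have Ew' : E^t* *m w = Q^t* *m (L^t* *m y) by rewrite Ew trmxC_mul mulmxA.
have [u Qu] := image_of_adj_relation Ew'.
rewrite -Ew -Qu; apply: storage_isotropic => //.
rewrite -EQ_sym -!mulmxA Qu Ew' Ly !mulmxN mulmxA -trmxC_mul Qu.
have := congr1 (fun M : 'M_1 => M^t*) zQw.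
rewrite !trmxC_mul !trmxCK trmxC0 -mulmxA -mulmxA Qz => h.
by rewrite h oppr0.
Qed.

End RegularLagrangianPencil.

(** * Blocks of a Kronecker form as direct summands *)

Section Summands.
Variable C : closedFieldType.

(** [(E0, A0)] is, up to equivalence, a direct summand of [(E, A)]: [P] and [D]
    project onto it the two sides of the pencil, along [X] and [B]. *)
Definition summand n0 m0 (E0 A0 : 'M[C]_(n0, m0)) n m (E A : 'M[C]_(n, m)) :=
  exists (D : 'M[C]_(n0, n)) (P : 'M[C]_(m0, m))
         (B : 'M[C]_(n, n0)) (X : 'M[C]_(m, m0)),
    [/\ D *m E = E0 *m P /\ D *m A = A0 *m P,
        E *m X = B *m E0 /\ A *m X = B *m A0,
        P *m X = 1%:M & D *m B = 1%:M].

Lemma summand_trans n0 m0 (E0 A0 : 'M[C]_(n0, m0)) n1 m1 (E1 A1 : 'M[C]_(n1, m1))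
    n m (E A : 'M[C]_(n, m)) :
  summand E0 A0 E1 A1 -> summand E1 A1 E A -> summand E0 A0 E A.
Proof.
move=> [D0 [P0 [B0 [X0 [[DE0 DA0] [EX0 AX0] PX0 DB0]]]]].
move=> [D1 [P1 [B1 [X1 [[DE1 DA1] [EX1 AX1] PX1 DB1]]]]].
exists (D0 *m D1), (P0 *m P1), (B1 *m B0), (X1 *m X0); split.
- by rewrite -!mulmxA DE1 DA1 !mulmxA DE0 DA0.
- by rewrite !mulmxA EX1 AX1 -!mulmxA EX0 AX0.
- by rewrite mulmxA -(mulmxA P0) PX1 mulmx1.
- by rewrite mulmxA -(mulmxA D0) DB1 mulmx1.
Qed.

Lemma summand_ul n1 m1 n2 m2 (E1 A1 : 'M[C]_(n1, m1)) (E2 A2 : 'M[C]_(n2, m2)) :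
  summand E1 A1 (block_mx E1 0 0 E2) (block_mx A1 0 0 A2).
Proof.
exists (row_mx 1%:M 0), (row_mx 1%:M 0), (col_mx 1%:M 0), (col_mx 1%:M 0).
split; rewrite ?mul_row_block ?mul_block_col ?mul_mx_row ?mul_col_mx ?mul_row_col;
  by rewrite ?mulmx1 ?mul1mx ?mulmx0 ?mul0mx ?addr0 ?mul0mx ?mulmx0.
Qed.

Lemma summand_dr n1 m1 n2 m2 (E1 A1 : 'M[C]_(n1, m1)) (E2 A2 : 'M[C]_(n2, m2)) :
  summand E2 A2 (block_mx E1 0 0 E2) (block_mx A1 0 0 A2).
Proof.
exists (row_mx 0 1%:M), (row_mx 0 1%:M), (col_mx 0 1%:M), (col_mx 0 1%:M).
split; rewrite ?mul_row_block ?mul_block_col ?mul_mx_row ?mul_col_mx ?mul_row_col;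
  by rewrite ?mulmx1 ?mul1mx ?mulmx0 ?mul0mx ?add0r ?mul0mx ?mulmx0.
Qed.

Lemma summand_blockdiag b s : b \in s ->
  summand (block_E b) (block_A b)
    (blockdiag (@block_E C) s) (blockdiag (@block_A C) s).
Proof.
elim: s => // c s IHs; rewrite inE => /predU1P[->|/IHs h] /=.
  exact: summand_ul.
exact: summand_trans h (summand_dr _ _ _ _).
Qed.

Lemma form_summand n m (E A : 'M[C]_(n, m)) s : is_kronecker_form E A s ->
  summand (blockdiag (@block_E C) s) (blockdiag (@block_A C) s) E A.
Proof.
move=> [_ [en [em [S [T []]]]]]; subst n; subst m; rewrite !castmx_id.
move=> Su Tu SET SAT; exists S, (invmx T), (invmx S), T.
split; rewrite ?mulVmx ?mulmxV // -?SET -?SAT ?mulmxK //.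
by rewrite -!mulmxA !mulKmx.
Qed.

Lemma kronecker_formP n m (E A : 'M[C]_(n, m)) b :
  b \in kronecker_form E A -> is_kronecker_form E A (kronecker_form E A).
Proof.
rewrite /kronecker_form; case: xgetP => [s -> //|] _.
by rewrite in_nil.
Qed.

Lemma kronecker_block n m (E A : 'M[C]_(n, m)) b :
  b \in kronecker_form E A ->
  block_ok b /\ summand (block_E b) (block_A b) E A.
Proof.
move=> bs; have h := kronecker_formP bs; split.
  by case: h => /allP/(_ b bs).
exact: summand_trans (summand_blockdiag bs) (form_summand h).
Qed.

(** Zero when [k] is out of range, so that the relations between consecutive
    vectors of a Kronecker chain also hold at its ends. *)
Definition evec p k : 'cV[C]_p := \col_i (i == k :> nat)%:R.

Lemma mul_evec n p (M : 'M[C]_(n, p)) k (kp : (k < p)%N) i :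
  (M *m evec p k) i 0 = M i (Ordinal kp).
Proof.
rewrite mxE (bigD1 (Ordinal kp)) //= mxE eqxx mulr1 big1 ?addr0 // => j.
by rewrite -val_eqE mxE /= => /negPf->; rewrite mulr0.
Qed.

Lemma evec_neq0 p k : (k < p)%N -> evec p k != 0.
Proof.
move=> kp; apply/eqP => /matrixP/(_ (Ordinal kp) 0).
by rewrite !mxE eqxx => /eqP; rewrite oner_eq0.
Qed.

Lemma evec_ge p k : (p <= k)%N -> evec p k = 0.
Proof.
by move=> pk; apply/matrixP=> i j; rewrite !mxE ltn_eqF // (leq_trans (ltn_ord i)).
Qed.

Lemma jordan_evec0 r lam : (0 < r)%N ->
  jordan_mx r lam *m evec r 0 = lam *: evec r 0.
Proof.
move=> r0; apply/matrixP=> i j; rewrite ord1 mul_evec !mxE -val_eqE /=.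
by rewrite addr0 mulr_natr.
Qed.

Lemma jordan_evecS r lam k : (k.+1 < r)%N ->
  jordan_mx r lam *m evec r k.+1 = lam *: evec r k.+1 + evec r k.
Proof.
move=> kr; apply/matrixP=> i j; rewrite ord1 mul_evec !mxE -val_eqE /=.
by rewrite mulr_natr eqSS.
Qed.

Lemma id_zero_evec e k : id_zero_mx C e *m evec e.+1 k = evec e k.
Proof.
apply/matrixP=> i j; rewrite ord1; have [ke|ek] := ltnP k e.+1.
  by rewrite mul_evec !mxE.
by rewrite evec_ge // mulmx0 !mxE ltn_eqF // (leq_trans (ltn_ord i)) // ltnW.
Qed.

Lemma zero_id_evecS e k : zero_id_mx C e *m evec e.+1 k.+1 = evec e k.
Proof.
apply/matrixP=> i j; rewrite ord1; have [ke|ek] := ltnP k.+1 e.+1.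
  by rewrite mul_evec !mxE eqSS.
by rewrite evec_ge // mulmx0 !mxE ltn_eqF // (leq_trans (ltn_ord i)).
Qed.

Lemma zero_id_evec0 e : zero_id_mx C e *m evec e.+1 0 = 0.
Proof. by apply/matrixP=> i j; rewrite ord1 mul_evec !mxE. Qed.

Lemma mul_id_zero e p (c : 'M[C]_(e.+1, p)) i j :
  (id_zero_mx C e *m c) i j = c (widen_ord (leqnSn e) i) j.
Proof.
rewrite mxE (bigD1 (widen_ord (leqnSn e) i)) //= mxE eqxx mul1r big1 ?addr0 // => k.
by rewrite -val_eqE mxE eq_sym /= => /negPf->; rewrite mul0r.
Qed.

Lemma mul_zero_id e p (c : 'M[C]_(e.+1, p)) i j :
  (zero_id_mx C e *m c) i j = c (lift ord0 i) j.
Proof.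
rewrite mxE (bigD1 (lift ord0 i)) //= mxE eqxx mul1r big1 ?addr0 // => k.
by rewrite -val_eqE mxE eq_sym /= => /negPf->; rewrite mul0r.
Qed.

Variables (n m : nat) (E A : 'M[C]_(n, m)).

(** For the last clause, suppose [lam != 0]: then [(v - a) lam + a z] would be a
    polynomial null vector in [z], through a multiple of [v] at [z = lam], whereas
    the projection of such a null vector to a regular summand is zero. *)
Lemma jordan_eigenvector lam r :
  block_ok (JordanBlock lam r) ->
  summand (block_E (JordanBlock lam r)) (block_A (JordanBlock lam r)) E A ->
  exists v : 'cV[C]_m,
    [/\ A *m v = lam *: (E *m v), E *m v != 0,
        (1 < r)%N -> exists w, A *m w = lam *: (E *m w) + E *m v &
        forall a, E *m a = 0 -> A *m a = A *m v -> lam = 0].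
Proof.
move=> /= r0 [D [P [B [X [[DE DA] [EX AX] PX DB]]]]].
have eqE k : E *m (X *m evec r k) = B *m evec r k.
  by rewrite mulmxA EX mulmx1.
have eqA k : A *m (X *m evec r k) = B *m (jordan_mx r lam *m evec r k).
  by rewrite mulmxA AX -mulmxA.
exists (X *m evec r 0); rewrite eqA eqE jordan_evec0 //; split.
- by rewrite scalemxAr.
- apply: contra (evec_neq0 r0) => /eqP h.
  by rewrite -[evec r 0]mul1mx -DB -mulmxA h mulmx0.
- move=> r1; exists (X *m evec r 1).
  by rewrite eqA eqE jordan_evecS // mulmxDr scalemxAr.
- move=> a Ea Aa; have Pa : P *m a = 0.
    by rewrite -[P]mul1mx -DE -mulmxA Ea mulmx0.
  move/(congr1 (mulmx D)): Aa; rewrite mulmxA DA -mulmxA Pa mulmx0 mulmxA DB mul1mx.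
  by move/esym/eqP; rewrite scaler_eq0 (negPf (evec_neq0 r0)) orbF => /eqP.
Qed.

(** The last clause is again that the chain belongs to a regular summand: with
    [A b = 0], the polynomial [z x0 + b] would be a null vector. *)
Lemma infinite_chain r :
  (2 < r)%N -> summand (block_E (InfBlock r)) (block_A (InfBlock r)) E A ->
  exists x0 x1 x2 : 'cV[C]_m,
    [/\ E *m x0 = 0, E *m x1 = A *m x0, E *m x2 = A *m x1 &
        forall b, E *m b = E *m x1 -> A *m b != 0].
Proof.
move=> /= r2 [D [P [B [X [[DE DA] [EX AX] PX DB]]]]].
have eqA k : A *m (X *m evec r k) = B *m evec r k.
  by rewrite mulmxA AX mulmx1.
have eqE k : E *m (X *m evec r k) = B *m (jordan_mx r 0 *m evec r k).
  by rewrite mulmxA EX -mulmxA.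
have r1 := ltnW r2; have r0 := ltnW r1.
exists (X *m evec r 0), (X *m evec r 1), (X *m evec r 2).
rewrite !eqA !eqE jordan_evec0 // !jordan_evecS // !scale0r !add0r mulmx0.
split=> // b Eb; apply/eqP => Ab.
have Pb : P *m b = 0 by rewrite -[P]mul1mx -DA -mulmxA Ab mulmx0.
move/(congr1 (mulmx D)): Eb; rewrite mulmxA DE -mulmxA Pb mulmx0 mulmxA DB mul1mx.
by move/esym/eqP; rewrite (negPf (evec_neq0 r0)).
Qed.

(** Read backwards, a right Kronecker chain starts like a chain at infinity.  With
    [A b = 0] it would already end after [x0] and [b]. *)
Lemma right_chain e :
  (1 < e)%N -> summand (block_E (@RightBlock C e)) (block_A (@RightBlock C e)) E A ->
  exists x0 x1 x2 : 'cV[C]_m,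
    [/\ E *m x0 = 0, E *m x1 = A *m x0, E *m x2 = A *m x1 &
        forall b, E *m b = E *m x1 -> A *m b != 0].
Proof.
case: e => [//|[//|e]] _ /= [D [P [B [X [[DE DA] [EX AX] PX DB]]]]].
have eqA k : A *m (X *m evec _ k.+1) = B *m evec _ k.
  by rewrite mulmxA AX -mulmxA zero_id_evecS.
have eqE k : E *m (X *m evec _ k) = B *m evec _ k.
  by rewrite mulmxA EX -mulmxA id_zero_evec.
exists (X *m evec _ e.+2), (X *m evec _ e.+1), (X *m evec _ e).
rewrite !eqA !eqE evec_ge // mulmx0; split=> // b Eb; apply/eqP => Ab.
have Pb : zero_id_mx C e.+2 *m (P *m b) = 0 by rewrite mulmxA -DA -mulmxA Ab mulmx0.
move/(congr1 (mulmx D)): Eb; rewrite mulmxA DE -mulmxA [RHS]mulmxA DB mul1mx.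
move: (P *m b) Pb => c Pb.
move=> cE; move/matrixP/(_ (inord e) 0): Pb; move/matrixP/(_ (inord e.+1) 0): cE.
rewrite mul_id_zero mul_zero_id !mxE inordK // eqxx.
have -> : lift ord0 (inord e : 'I_e.+2) = widen_ord (leqnSn e.+2) (inord e.+1).
  by apply: val_inj; rewrite /= /bump /= !inordK // ltnW.
by move=> -> /eqP; rewrite oner_eq0.
Qed.

(** When [e = 1] the chain has only two rows, and [p = 0]. *)
Lemma left_chain e :
  (0 < e)%N -> summand (block_E (@LeftBlock C e)) (block_A (@LeftBlock C e)) E A ->
  exists y w p : 'rV[C]_n,
    [/\ y *m E = 0, w *m E = y *m A, p *m E = w *m A & y *m A != 0].
Proof.
case: e => [//|e] _ /= [D [P [B [X [[DE DA] [EX AX] PX DB]]]]].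
pose y k := (evec e.+2 k)^T *m D.
have eqE k : y k *m E = (evec e.+1 k)^T *m P.
  by rewrite -mulmxA DE mulmxA -trmx_mul id_zero_evec.
have eqA k : y k.+1 *m A = (evec e.+1 k)^T *m P.
  by rewrite -mulmxA DA mulmxA -trmx_mul zero_id_evecS.
exists (y e.+1), (y e), (if (0 < e)%N then y e.-1 else 0).
rewrite !eqE eqA evec_ge // trmx0 mul0mx; split=> //.
- case: posnP => [e0|e_gt0]; last first.
    have -> : y e = y e.-1.+1 by rewrite prednK.
    by rewrite eqE eqA.
  have -> : y e = y 0 by congr (y _).
  by rewrite mul0mx -mulmxA DA mulmxA -trmx_mul zero_id_evec0 trmx0 mul0mx.
- apply: contra (evec_neq0 (ltnSn e)) => /eqP h.
  have -> : evec e.+1 e = ((evec e.+1 e)^T *m P *m X)^T.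
    by rewrite -mulmxA PX mulmx1 trmxK.
  by rewrite h mul0mx trmx0.
Qed.

End Summands.

(** * Regular pencils and deflating subspaces *)

Section RegularPencils.
Variable C : closedFieldType.

Lemma regular_pencil_value n m (E A : 'M[C]_(n, m)) : regular_pencil E A ->
  exists mu, [/\ n = m,
    forall v : 'cV_m, (mu *: E - A) *m v = 0 -> v = 0 &
    forall w : 'rV_n, w *m (mu *: E - A) = 0 -> w = 0].
Proof.
move=> [e]; subst m; rewrite castmx_id => /closed_nonrootP[mu].
rewrite /root -[_.[mu]]/(horner_eval mu _) -det_map_mx.
have -> : map_mx (horner_eval mu) (pencil_mx E A) = mu *: E - A.
  apply/matrixP=> i j; rewrite !mxE /= /horner_eval.
  by rewrite hornerD hornerN hornerM hornerX !hornerC.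
rewrite -unitfE -[_ \is a _]/(_ \in unitmx) => u; exists mu; split=> // x.
  by move/(congr1 (mulmx (invmx (mu *: E - A)))); rewrite mulKmx // mulmx0.
by move/(congr1 (mulmx^~ (invmx (mu *: E - A)))); rewrite mulmxK // mul0mx.
Qed.

Lemma power_null_vector e (mu : C) (v : 'cV[C]_e.+1 := \col_i mu ^+ i) :
  (mu *: id_zero_mx C e - zero_id_mx C e) *m v = 0.
Proof.
rewrite mulmxBl -scalemxAl; apply/eqP; rewrite subr_eq0; apply/eqP/matrixP=> i j.
by rewrite [LHS]mxE mul_id_zero mul_zero_id !mxE /= /bump /= add1n exprS.
Qed.

Lemma regular_no_right e n m (E A : 'M[C]_(n, m)) : regular_pencil E A ->
  ~ summand (block_E (@RightBlock C e)) (block_A (@RightBlock C e)) E A.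
Proof.
move=> /regular_pencil_value[mu [_ inj _]] /= [D [P [B [X [_ [EX AX] PX _]]]]].
pose v : 'cV[C]_e.+1 := \col_i mu ^+ i.
suff Xv : X *m v = 0.
  have : v = 0 by rewrite -[v]mul1mx -PX -mulmxA Xv mulmx0.
  by move/matrixP/(_ 0 0)/eqP; rewrite !mxE oner_eq0.
apply: inj; rewrite mulmxA mulmxBl -scalemxAl EX AX scalemxAr -mulmxBr.
by rewrite -mulmxA power_null_vector mulmx0.
Qed.

Lemma regular_no_left e n m (E A : 'M[C]_(n, m)) : regular_pencil E A ->
  ~ summand (block_E (@LeftBlock C e)) (block_A (@LeftBlock C e)) E A.
Proof.
move=> /regular_pencil_value[mu [_ _ inj]] /= [D [P [B [X [[DE DA] _ _ DB]]]]].
pose v : 'cV[C]_e.+1 := \col_i mu ^+ i.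
suff vD : v^T *m D = 0.
  have : v^T = 0 by rewrite -[v^T]mulmx1 -DB mulmxA vD mul0mx.
  by move/matrixP/(_ 0 0)/eqP; rewrite !mxE oner_eq0.
apply: inj; rewrite -mulmxA mulmxBr -scalemxAr DE DA scalemxAl -mulmxBl.
rewrite mulmxA -[_ - _]trmxK -trmx_mul linearB linearZ /= !trmxK.
by rewrite power_null_vector trmx0 mul0mx.
Qed.

Lemma blockdiag_scale s lam :
  {in s, forall b, block_A b = lam *: block_E b :> 'M[C]_(_, _)} ->
  blockdiag (@block_A C) s = lam *: blockdiag (@block_E C) s.
Proof.
elim: s => [|b s IHs] h /=; first by rewrite scaler0.
rewrite scale_block_mx !scaler0 h ?mem_head // IHs // => c cs.
by apply: h; rewrite inE cs orbT.
Qed.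

(** Every block of the pencil [(E0, A0)] carried by the subspace is a block of
    [(E, A)], hence a [1 x 1] block with eigenvalue [lam]. *)
Lemma deflating_eigenvectors n m (E A : 'M[C]_(n, m)) lam (U : {vspace 'cV[C]_m}) :
  regular_deflating_subspace E A lam U ->
  (forall r, (0 < r)%N ->
     summand (block_E (JordanBlock lam r)) (block_A (JordanBlock lam r)) E A ->
     r = 1%N) ->
  {in U, forall v, A *m v = lam *: (E *m v)}.
Proof.
move=> [_ _ [p [q [en [em [X [Y [E0 [A0 [E1 [A1 []]]]]]]]]]]] + + + + _ ss.
move: (algebraic_multiplicity _ _ _) => k in en em X Y E0 A0 *.
subst n m; rewrite !castmx_id => -[uX uY] -> [eqE eqA] [reg ev noinf].
have [sub [EX AX]] : summand E0 A0 E A /\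
  (E *m lsubmx X = lsubmx (invmx Y) *m E0 /\ A *m lsubmx X = lsubmx (invmx Y) *m A0).
  have YE M M0 M1 : Y *m M *m X = block_mx M0 0 0 M1 ->
      usubmx Y *m M = M0 *m usubmx (invmx X) /\
      M *m lsubmx X = lsubmx (invmx Y) *m M0.
    move=> e; split.
      rewrite mul_usub_mx; have -> : Y *m M = block_mx M0 0 0 M1 *m invmx X.
        by rewrite -e mulmxK.
      by rewrite -[invmx X]vsubmxK mul_block_col mul0mx addr0 col_mxKu col_mxKu.
    rewrite mulmx_lsub /=; have -> : M *m X = invmx Y *m block_mx M0 0 0 M1.
      by rewrite -e -mulmxA mulKmx.
    by rewrite -[invmx Y]hsubmxK mul_row_block mulmx0 addr0 !row_mxKl.
  have [DE EX] := YE _ _ _ eqE; have [DA AX] := YE _ _ _ eqA.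
  split; last by [].
  exists (usubmx Y), (usubmx (invmx X)), (lsubmx (invmx Y)), (lsubmx X).
  split=> //.
    by rewrite mul_usub_mx mulmx_lsub mulVmx // scalar_mx_block block_mxEh row_mxKl col_mxKu.
  by rewrite mul_usub_mx mulmx_lsub mulmxV // scalar_mx_block block_mxEh row_mxKl col_mxKu.
have [r0 r0s] : finite_eigenvalue E0 A0 lam by apply/ev.
have [oks [en [em [S [T [uS uT SET SAT]]]]]] := kronecker_formP r0s.
have eqs : A0 = lam *: E0.
  have : blockdiag (@block_A C) (kronecker_form E0 A0)
      = lam *: blockdiag (@block_E C) (kronecker_form E0 A0).
    apply: blockdiag_scale => b bs; have [okb sb] := kronecker_block bs.
    case: b bs okb sb => [e|e|mu r|r] bs okb sb.
    - by case: (regular_no_right reg sb).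
    - by case: (regular_no_left reg sb).
    - have emu : mu = lam by apply/ev; exists r.
      subst mu; have r1 := ss r okb (summand_trans sb sub); subst r.
      by apply/matrixP=> i j; rewrite !ord1 !mxE addr0 mulr1.
    - by case: noinf; exists r.
  rewrite -SET -SAT => h; have {h} : S *m A0 *m T = lam *: (S *m E0 *m T).
    apply: (can_inj (castmxK en em)).
    by rewrite h; apply/matrixP=> i j; rewrite !(castmxE, mxE).
  move/(congr1 (mulmx^~ (invmx T))); rewrite -scalemxAl !mulmxK //.
  by rewrite scalemxAr => /(can_inj (mulKmx uS)).
move=> v vU; have {vU} : exists c, v = lsubmx X *m c.
  exists (\col_i coord (columns (lsubmx X)) i v).
  apply/matrixP=> i j; rewrite {1}(coord_span vU) summxE ord1 [RHS]mxE.
  apply: eq_bigr => l _.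
  by rewrite (nth_map l) ?size_enum_ord // nth_ord_enum !mxE mulrC.
by case=> c ->; rewrite !mulmxA EX AX eqs -scalemxAr -scalemxAl.
Qed.

End RegularPencils.

(** * Kronecker forms up to blocks without columns *)

Section PartialForms.
Variable C : closedFieldType.

Lemma mul_row_block_diag p n1 n2 m1 m2 (X : 'M[C]_(p, n1)) (Y : 'M[C]_(p, n2))
    (M : 'M[C]_(n1, m1)) (N : 'M[C]_(n2, m2)) :
  row_mx X Y *m block_mx M 0 0 N = row_mx (X *m M) (Y *m N).
Proof. by rewrite mul_row_block !mulmx0 addr0 add0r. Qed.

(** A Kronecker form of the pencil restricted, on the side of the rows, to the
    images of [E] and [A]: the columns of [T] form a basis, those of [B] are only
    independent and missing the blocks [LeftBlock 0]. *)
Definition partial_form n m (E A : 'M[C]_(n, m)) (s : seq (kblock C)) :=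
  exists (T : 'M[C]_(m, form_cols s)) (B : 'M[C]_(n, form_rows s)),
    [/\ all (@block_ok C) s /\ form_cols s = m,
        row_free T, row_free B^T,
        E *m T = B *m blockdiag (@block_E C) s /\
          A *m T = B *m blockdiag (@block_A C) s &
        (B^T <= E^T + A^T)%MS].

Lemma row_free_trP n p (B : 'M[C]_(n, p)) :
  reflect (forall c : 'cV_p, B *m c = 0 -> c = 0) (row_free B^T).
Proof.
apply: (iffP idP) => [fB c Bc|inj].
  apply: trmx_inj; apply: (row_free_inj fB); rewrite -trmx_mul Bc.
  by rewrite !trmx0 mul0mx.
apply: inj_row_free => v; move/(congr1 trmx); rewrite trmx_mul trmxK trmx0.
by move/inj/(congr1 trmx); rewrite trmxK trmx0.
Qed.

Lemma partial_form_complete n m (E A : 'M[C]_(n, m)) s : partial_form E A s ->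
  exists k, is_kronecker_form E A (nseq k (@LeftBlock C 0) ++ s).
Proof.
move=> [T [B [[oks ms] fT fB eqs _]]].
have [k nk] : exists k, (k + form_rows s)%N = n.
  exists (n - form_rows s)%N; apply: subnK.
  by move: fB; rewrite /row_free => /eqP <-; apply: rank_leq_col.
exists k; elim: k s T B oks ms fT fB eqs nk => [|k IHk] s T B oks ms fT fB [eqE eqA] nk.
  split=> //=; rewrite add0n in nk; subst n; subst m; exists erefl, erefl, (invmx B), T.
  have uB : B \in unitmx by rewrite -unitmx_tr -row_free_unit.
  split; [by rewrite unitmx_inv|by rewrite -row_free_unit| |].
    by rewrite castmx_id -mulmxA eqE mulKmx.
  by rewrite castmx_id -mulmxA eqA mulKmx.
have [w wB] : exists w : 'cV_n, ~~ (w^T <= B^T)%MS.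
  have : ~~ (1%:M <= B^T)%MS.
    apply/negP=> /mxrankS; rewrite mxrank1 (eqP fB) => le.
    by move: le; rewrite -nk addSn ltnNge leq_addl.
  by case/row_subPn=> i h; exists (row i 1%:M)^T; rewrite trmxK.
have -> : nseq k.+1 (@LeftBlock C 0) ++ s = nseq k (LeftBlock 0) ++ LeftBlock 0 :: s.
  by rewrite -[k.+1]addn1 nseqD -catA.
apply: (IHk (LeftBlock 0 :: s) (row_mx (0 : 'M_(m, 0)) T) (row_mx w B)) => //.
- have /row_freeP[Z TZ] := fT; apply/row_freeP; exists (col_mx 0 Z).
  by rewrite mul_row_col TZ mul0mx add0r.
- apply/row_free_trP => c; rewrite -[c]vsubmxK mul_row_col.
  move: (usubmx c : 'cV_1) (dsubmx c : 'cV_(form_rows s)) => c1 c2 h.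
  have c10 : c1 = 0.
    apply/eqP; apply: contraNT wB => c1n.
    have c1s : c1 0 0 != 0.
      by apply: contra c1n => /eqP h0; apply/eqP/matrixP=> i j; rewrite !ord1 h0 mxE.
    apply/submxP; exists (- (c1 0 0)^-1 *: c2^T); apply: trmx_inj.
    rewrite trmxK trmx_mul trmxK linearZ /= trmxK -scalemxAr.
    move/eqP: h; rewrite addrC addr_eq0 => /eqP->.
    have -> : w *m c1 = c1 0 0 *: w by rewrite {1}[c1]mx11_scalar mul_mx_scalar.
    by rewrite scalerN scalerA mulNr mulVf // scaleN1r opprK.
  move: h; rewrite c10 mulmx0 add0r => /(row_free_trP _ fB)->.
  by rewrite col_mx0.
- rewrite /= !mul_mx_row !mul_row_block_diag eqE eqA.
  by split; congr row_mx; rewrite [LHS]thinmx0 [RHS]thinmx0.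
- by rewrite -nk /form_rows /= add1n addSnnS.
Qed.

(** The rows [Y] annihilate the complement [K] on the image side, which keeps the
    columns of [Z] independent of those found for [K]. *)
Lemma partial_form_cons b s n m p (E A : 'M[C]_(n, m)) (X : 'M[C]_(m, block_cols b))
    (K : 'M[C]_(m, p)) (Z : 'M[C]_(n, block_rows b)) (Y : 'M[C]_(block_rows b, n)) :
  block_ok b -> (block_cols b + p)%N = m -> row_free (row_mx X K) ->
  E *m X = Z *m block_E b -> A *m X = Z *m block_A b ->
  (Z^T <= E^T + A^T)%MS ->
  Y *m Z = 1%:M -> Y *m (E *m K) = 0 -> Y *m (A *m K) = 0 ->
  partial_form (E *m K) (A *m K) s -> partial_form E A (b :: s).
Proof.
move=> okb bp /row_freeP[W XKW] EX AX ZEA YZ YE YA [T [B [[oks sp] fT fB [eqE eqA] BEA]]].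
have YB : Y *m B = 0.
  have /sub_addsmxP[[u1 u2] /= /(congr1 trmx)] := BEA.
  rewrite trmxK linearD /= trmx_mul trmxK [(u2 *m _)^T]trmx_mul trmxK => ->.
  by rewrite mulmxDr ![Y *m (_ *m _^T)]mulmxA YE YA !mul0mx addr0.
exists (row_mx X (K *m T)), (row_mx Z B); split.
- by rewrite /= okb oks /form_cols /= -[sumn _]/(form_cols s) sp.
- have /row_freeP[V TV] := fT; apply/row_freeP.
  exists (block_mx 1%:M 0 0 V *m W); rewrite mulmxA mul_row_block_diag mulmx1.
  by rewrite -mulmxA TV mulmx1.
- apply/row_free_trP => c; rewrite -[c]vsubmxK mul_row_col => h.
  have c1 : usubmx c = 0.
    move/(congr1 (mulmx Y)): h; rewrite mulmxDr !mulmxA YZ YB mul1mx mul0mx addr0.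
    by rewrite mulmx0.
  by move: h; rewrite c1 mulmx0 add0r => /(row_free_trP _ fB)->; rewrite col_mx0.
- by rewrite /= !mul_mx_row !mul_row_block_diag EX AX !mulmxA eqE eqA.
- rewrite tr_row_mx col_mx_sub ZEA (submx_trans BEA) // !trmx_mul.
  by rewrite addsmx_sub !(submx_trans (submxMl _ _)) ?addsmxSl ?addsmxSr.
Qed.

End PartialForms.

(** * Pencils with only left Kronecker chains *)

Section InjectivePencils.
Variable C : closedFieldType.

Lemma mul_id_zero_tr e p (c : 'M[C]_(p, e.+1)) i j :
  (c *m (id_zero_mx C e)^T) i j = c i (widen_ord (leqnSn e) j).
Proof.
have := mul_id_zero c^T j i; rewrite [RHS]mxE => <-.
by rewrite -[c in LHS]trmxK -trmx_mul mxE.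
Qed.

Lemma mul_zero_id_tr e p (c : 'M[C]_(p, e.+1)) i j :
  (c *m (zero_id_mx C e)^T) i j = c i (lift ord0 j).
Proof.
have := mul_zero_id c^T j i; rewrite [RHS]mxE => <-.
by rewrite -[c in LHS]trmxK -trmx_mul mxE.
Qed.

Lemma glue_overlap e n (X Y : 'M[C]_(n, e.+1)) :
  Y *m (id_zero_mx C e)^T = X *m (zero_id_mx C e)^T ->
  exists Z : 'M[C]_(n, e.+2),
    X = Z *m (id_zero_mx C e.+1)^T /\ Y = Z *m (zero_id_mx C e.+1)^T.
Proof.
move=> YX; pose z i (j : 'I_e.+2) :=
  if insub (val j) is Some k then X i k else Y i ord_max.
exists (\matrix_(i, j) z i j); split; apply/matrixP=> i j.
  rewrite mul_id_zero_tr mxE /z insubT /= => [|lt]; first by [].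
  by congr (X i _); apply: val_inj.
rewrite mul_zero_id_tr mxE /z; case: insubP => [k _ ek|]; last first.
  rewrite -leqNgt /= /bump /= => je; congr (Y i _); apply: val_inj => /=.
  by apply/eqP; rewrite eqn_leq -ltnS ltn_ord.
have je : (j < e)%N by have := ltn_ord k; rewrite ek /= /bump /= add1n ltnS.
have /matrixP/(_ i (Ordinal je)) := YX; rewrite mul_id_zero_tr mul_zero_id_tr.
have -> : widen_ord (leqnSn e) (Ordinal je) = j by apply: val_inj.
by move=> ->; congr (X i _); apply: val_inj; rewrite ek.
Qed.

Definition lefts es : seq (kblock C) := [seq LeftBlock e | e <- es].

Lemma form_cols_succ es : form_cols (lefts [seq e.+1 | e <- es]) = form_rows (lefts es).
Proof. by rewrite /form_cols /form_rows /lefts -!map_comp. Qed.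

Lemma form_rows_lefts es : form_rows (lefts es) = (form_cols (lefts es) + size es)%N.
Proof.
rewrite /form_cols /form_rows; elim: es => //= e es ->.
by rewrite addSn addnS addnA.
Qed.

(** The chains in [F] are chains of the derived pencil; applying [E] to each of
    them and appending the image by [Q] of its last vector makes it one longer. *)
Lemma lift_chains n m (E Q : 'M[C]_(n, m)) es (F : 'M[C]_(m, form_rows (lefts es))) :
  Q *m (F *m blockdiag (@block_E C) (lefts es)) =
    E *m (F *m blockdiag (@block_A C) (lefts es)) ->
  let s := lefts [seq e.+1 | e <- es] in
  exists (T : 'M[C]_(m, form_cols s)) (B : 'M[C]_(n, form_rows s)),
    [/\ E *m T = B *m blockdiag (@block_E C) s,
        Q *m T = B *m blockdiag (@block_A C) s & (F^T <= T^T)%MS].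
Proof.
elim: es F => [|e es IHes] F /=.
  exists 0, 0; rewrite ?mulmx0 ?mul0mx; split=> //.
  by have -> : F^T = 0; rewrite ?[LHS]flatmx0 ?sub0mx.
rewrite -[F]hsubmxK; move: (lsubmx F : 'M_(m, e.+1)) (rsubmx F) => F1 F2.
rewrite !mul_row_block_diag !mul_mx_row => /eq_row_mx[].
rewrite !mulmxA => /glue_overlap[B1 [EF1 QF1]] h2.
have [|T2 [B2 [E2 Q2 FT2]]] := IHes F2; first by rewrite !mulmxA.
exists (row_mx F1 T2), (row_mx B1 B2).
rewrite !mul_mx_row !mul_row_block_diag E2 Q2 EF1 QF1; split=> //.
rewrite !tr_row_mx -!addsmxE; apply: addsmxS; rewrite ?submx_refl //.
Qed.

Lemma castmx_solve n m n' m' (en : n = n') (em : m = m') (S : 'M[C]_n)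
    (V : 'M[C]_m) (M : 'M[C]_(n, m)) N :
  S \in unitmx -> castmx (en, em) (S *m M *m V) = N ->
  M *m castmx (erefl m, em) V = castmx (erefl n, en) (invmx S) *m N.
Proof. by move=> uS <-; subst n' m'; rewrite !castmx_id -mulmxA mulKmx. Qed.

Definition everywhere_injective n m (E Q : 'M[C]_(n, m)) :=
  forall a b (v : 'cV_m), a *: (E *m v) + b *: (Q *m v) = 0 ->
    v = 0 \/ a = 0 /\ b = 0.

(** The columns of [J] span the [v] with [Q v] in the image of [E], and [K] is
    [E^-1 Q J] when [E] is injective.  Both come from the kernel of [E] and [- Q]
    side by side, which also gives the dimension. *)
Lemma derived_pencil n m (E Q : 'M[C]_(n, m)) :
  exists p (J K : 'M[C]_(m, p)),
    [/\ E *m K = Q *m J, (p + \rank (E^T + Q^T)%MS)%N = (m + m)%N &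
        forall c : 'cV_p, J *m c = 0 -> K *m c = 0 -> c = 0].
Proof.
pose N := (col_mx E^T (- Q^T)).
exists (\rank (kermx N)), (rsubmx (row_base (kermx N)))^T, (lsubmx (row_base (kermx N)))^T.
have fR : row_free (row_base (kermx N)) by apply: row_base_free.
have RN : row_base (kermx N) *m N = 0.
  by apply/eqP; rewrite -sub_kermx eq_row_base.
move: (row_base (kermx N)) fR RN => R fR RN; split.
- move: RN; rewrite -[R]hsubmxK mul_row_col mulmxN => /eqP; rewrite subr_eq0.
  by move=> /eqP/(congr1 trmx); rewrite !trmx_mul !trmxK hsubmxK.
- rewrite mxrank_ker; have -> : \rank (E^T + Q^T)%MS = \rank N.
    rewrite /N -(addsmxE E^T (- Q^T)).
    by rewrite (adds_eqmx (eqmx_refl _) (eqmx_opp _)).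
  by rewrite subnK // rank_leq_row.
- move=> c Jc Kc; apply/(row_free_trP R^T); first by rewrite trmxK.
  by rewrite -[R]hsubmxK tr_row_mx mul_col_mx Jc Kc col_mx0.
Qed.

Lemma derived_injective n m p (E Q : 'M[C]_(n, m)) (J K : 'M[C]_(m, p)) :
  everywhere_injective E Q -> E *m K = Q *m J ->
  (forall c : 'cV_p, J *m c = 0 -> K *m c = 0 -> c = 0) ->
  (forall c : 'cV_p, J *m c = 0 -> c = 0) /\ everywhere_injective J K.
Proof.
move=> inj EK injJK.
have injE (v : 'cV_m) : E *m v = 0 -> v = 0.
  move=> Ev; have [|//|[/eqP]] := inj 1 0 v; last by rewrite oner_eq0.
  by rewrite Ev scaler0 scale0r addr0.
have injJ (c : 'cV_p) : J *m c = 0 -> c = 0.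
  move=> Jc; apply: injJK => //; apply: injE.
  by rewrite mulmxA EK -mulmxA Jc mulmx0.
split=> // a b c h; have [||] := inj a b (J *m c); last by right.
  by rewrite [Q *m _]mulmxA -EK -mulmxA !scalemxAr -mulmxDr -!scalemxAr h mulmx0.
by move/injJ; left.
Qed.

(** Otherwise [J] is invertible and [K - a J] is singular for an eigenvalue [a] of
    [J^-1 K]. *)
Lemma derived_smaller m p (J K : 'M[C]_(m, p)) :
  (0 < m)%N -> (forall c : 'cV_p, J *m c = 0 -> c = 0) ->
  everywhere_injective J K -> (p < m)%N.
Proof.
move=> m0 injJ inj.
have fJ : row_free J^T by apply/row_free_trP.
have : (p <= m)%N by rewrite -(eqP fJ) rank_leq_col.
rewrite leq_eqVlt => /predU1P[pm|//]; subst p.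
have uJ : J \in unitmx by rewrite -unitmx_tr -row_free_unit.
pose M := (invmx J *m K)^T.
have [a ra] : exists a, root (char_poly M) a.
  by apply/closed_rootP; rewrite size_char_poly eqSS -lt0n.
have /eigenvalueP[v vM v0] : eigenvalue M a by rewrite eigenvalue_root_char.
have Kv : K *m v^T = a *: (J *m v^T).
  move/(congr1 trmx): vM; rewrite trmx_mul trmxK linearZ /= => h.
  by rewrite scalemxAr -h -mulmxA mulKVmx.
have [||[_ /eqP]] := inj (- a) 1 v^T; last by rewrite oner_eq0.
  by rewrite Kv scaleNr scale1r addNr.
by move/(congr1 trmx); rewrite trmxK trmx0 => /eqP; rewrite (negPf v0).
Qed.

(** By induction through the derived pencil: a Kronecker form of it consists of
    chains spanning the domain of [(E, Q)], and each of them gets longer by one.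
    The rank of [E^T + Q^T] equals the number of vectors in the longer chains, so
    these are independent. *)
Lemma injective_form m n (E Q : 'M[C]_(n, m)) :
  everywhere_injective E Q -> exists es, partial_form E Q (lefts es).
Proof.
elim/ltn_ind: m n E Q => m IHm n E Q inj.
have [m0|m_gt0] := posnP m.
  subst m; exists [::], 0, 0; split; rewrite ?mulmx0 ?mul0mx //.
  - by rewrite /row_free mxrank0.
  - by rewrite /row_free trmx0 mxrank0.
  - by rewrite trmx0 sub0mx.
have [p [J [K [EK rk injJK]]]] := derived_pencil E Q.
have [injJ injd] := derived_injective inj EK injJK.
have [es /partial_form_complete[k]] := IHm p (derived_smaller m_gt0 injJ injd) _ _ _ injd.
have -> : nseq k (@LeftBlock C 0) ++ lefts es = lefts (nseq k 0 ++ es).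
  by rewrite /lefts map_cat map_nseq.
move: (nseq k 0 ++ es) => {}es [_ [em [ep [S [V [uS uV SJV SKV]]]]]].
pose F := castmx (erefl m, em) (invmx S).
have eqJ := castmx_solve uS SJV; have eqK := castmx_solve uS SKV.
have [|T [B [ET QT FT]]] := @lift_chains n m E Q es F.
  by rewrite -eqJ -eqK !mulmxA EK.
set s := lefts [seq e.+1 | e <- es] in T B ET QT FT *.
have sm : form_cols s = m by rewrite form_cols_succ.
have fT : row_free T.
  rewrite /row_free eqn_leq rank_leq_row /= -mxrank_tr.
  apply: leq_trans (mxrankS FT); rewrite mxrank_tr /F; clear -uS em.
  by case: _ / em; rewrite castmx_id mxrank_unit // unitmx_inv.
have /row_freeP[Z TZ] := fT.
have sub M N : M *m T = B *m N -> (M^T <= B^T)%MS.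
  by move=> e; rewrite -[M]mulmx1 -TZ mulmxA e -mulmxA trmx_mul submxMl.
have EQB : (E^T + Q^T <= B^T)%MS by rewrite addsmx_sub (sub _ _ ET) (sub _ _ QT).
have srk : form_rows s = \rank (E^T + Q^T)%MS.
  apply/eqP; rewrite -(eqn_add2l p) rk form_rows_lefts sm size_map.
  by rewrite addnCA eqn_add2l ep -form_rows_lefts em.
exists [seq e.+1 | e <- es]; exists T, B; split=> //.
- by split=> //; apply/allP=> b /mapP[e _ ->].
- by rewrite /row_free eqn_leq rank_leq_row /= {1}srk mxrankS.
- have := mxrank_leqif_sup EQB; rewrite -srk => h.
  by rewrite -(geq_leqif h) rank_leq_row.
Qed.

End InjectivePencils.

(** * Kronecker forms of Lagrangian pencils *)

Section LagrangianForm.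
Variable C : numClosedFieldType.

Lemma kernel_basis m (f : 'rV[C]_m.+1) : f != 0 ->
  exists K : 'M[C]_(m.+1, m), f *m K = 0 /\
    forall v : 'cV_m.+1, f *m v != 0 -> row_free (row_mx v K).
Proof.
move=> f0; have rk : \rank (kermx f^T) = m.
  by rewrite mxrank_ker mxrank_tr rank_rV f0 subn1.
have basis p : \rank (kermx f^T) = p ->
    exists2 R : 'M[C]_(p, m.+1), row_free R & R *m f^T = 0.
  move=> <-; exists (row_base (kermx f^T)); first exact: row_base_free.
  by apply/eqP; rewrite -sub_kermx eq_row_base.
have [R fR Rf] := basis m rk.
exists R^T; have fK : f *m R^T = 0.
  by apply: trmx_inj; rewrite trmx_mul trmxK Rf trmx0.
split=> // v fv.
suff: row_free (row_mx v R^T)^T by rewrite /row_free mxrank_tr.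
apply/row_free_trP => c; rewrite -[c]vsubmxK mul_row_col.
move: (usubmx c : 'cV_1) (dsubmx c : 'cV_m) => c1 c2 h.
have c10 : c1 = 0.
  move/(congr1 (mulmx f)): h; rewrite mulmxDr !mulmxA fK mul0mx addr0 mulmx0.
  rewrite [f *m v]mx11_scalar mul_scalar_mx => /eqP; rewrite scaler_eq0.
  case/orP=> [/eqP h|/eqP //]; case/negP: fv.
  by rewrite [f *m v]mx11_scalar h raddf0.
move: h; rewrite c10 mulmx0 add0r => h.
rewrite (row_free_trP R^T _ c2 h) ?col_mx0 //.
by rewrite trmxK.
Qed.

Lemma dependent_pair n (x y : 'cV[C]_n) a b :
  a *: x + b *: y = 0 -> ~ (a = 0 /\ b = 0) ->
  exists (z : 'cV[C]_n) e q,
    [/\ x = e *: z, y = q *: z, (z = x \/ z = y) & e != 0 \/ q != 0].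
Proof.
move=> h ab; have [a0|a_neq0] := eqVneq a 0.
  have b0 : b != 0 by apply/eqP=> b0; apply: ab.
  exists x, 1, 0; rewrite scale1r scale0r oner_neq0; split=> //; try by left.
  by move/eqP: h; rewrite a0 scale0r add0r scaler_eq0 (negPf b0) => /eqP.
exists y, (- (a^-1 * b)), 1; rewrite scale1r oner_neq0; split=> //; try by right.
have := congr1 (fun u => a^-1 *: u) h.
rewrite /= scaler0 scalerDr !scalerA mulVf // scale1r => /eqP.
by rewrite addr_eq0 -scaleNr => /eqP.
Qed.

(** A vector [v] with [E v] and [Q v] on one line [z] splits off orthogonally:
    the symmetry of [E^* Q] makes [z^* E] and [z^* Q] proportional, so that they
    have a common kernel of codimension one. *)
Lemma lagrangian_partial_form m n (E Q : 'M[C]_(n, m)) :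
  E^t* *m Q = Q^t* *m E -> exists s, partial_form E Q s.
Proof.
elim: m => [|m IHm] in E Q *.
  move=> _; exists [::], 0, 0; split; rewrite ?mulmx0 ?mul0mx //.
  - by rewrite /row_free mxrank0.
  - by rewrite /row_free trmx0 mxrank0.
  - by rewrite trmx0 sub0mx.
move=> sym; have IH (K : 'M_(m.+1, m)) : exists s, partial_form (E *m K) (Q *m K) s.
  by apply: IHm; rewrite !trmxC_mul -!mulmxA; congr (_ *m _); rewrite !mulmxA sym.
have [inj|/existsNP[a /existsNP[b /existsNP[v /not_implyP[h]]]]] :=
    pselect (everywhere_injective E Q).
  by have [es] := injective_form inj; exists (lefts C es).
move=> /not_orP[v0 ab].
have vv : v^t* *m v != 0 by apply/eqP => /gram_eq0.
have [z [e [q [Ev Qv zEQ eq0]]]] := dependent_pair h ab.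
have [z0|z0] := eqVneq z 0.
  have vt0 : v^t* != 0 by apply: contraNneq vv => ->; rewrite mul0mx.
  have [K [_ /(_ _ vv) fK]] := kernel_basis vt0; have [s ps] := IH K.
  exists (RightBlock 0 :: s).
  apply: (@partial_form_cons _ (RightBlock 0) s n m.+1 m E Q v K 0 0) => //.
  - by rewrite Ev z0 scaler0 mul0mx.
  - by rewrite Qv z0 scaler0 mul0mx.
  - by rewrite trmx0 sub0mx.
  - by rewrite [LHS]flatmx0 [RHS]flatmx0.
  - by rewrite mul0mx.
  - by rewrite mul0mx.
have zz : (z^t* *m z) 0 0 != 0.
  apply: contra z0 => /eqP zz; apply/eqP/gram_eq0.
  by rewrite [LHS]mx11_scalar zz raddf0.
have prop : e^* *: (z^t* *m Q) = q^* *: (z^t* *m E).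
  by rewrite !scalemxAl -!trmxCZ -Ev -Qv !trmxC_mul -!mulmxA sym.
have zsub : (z^T <= E^T + Q^T)%MS.
  case: zEQ => ->; rewrite trmx_mul (submx_trans (submxMl _ _)) //.
    exact: addsmxSl.
  exact: addsmxSr.
have [K [fK [EK QK]]] : exists K : 'M_(m.+1, m), [/\ row_free (row_mx v K),
    z^t* *m (E *m K) = 0 & z^t* *m (Q *m K) = 0].
  have [e0|e_neq0] := eqVneq e 0.
    have q0 : q != 0 by case: eq0; rewrite // e0 eqxx.
    have zE : z^t* *m E = 0.
      move/esym/eqP: prop; rewrite e0 rmorph0 scale0r scaler_eq0 conjC_eq0.
      by rewrite (negPf q0) => /eqP.
    have zQv : z^t* *m Q *m v != 0.
      rewrite -mulmxA Qv -scalemxAr scaler_eq0 negb_or q0 /=.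
      by apply: contra zz => /eqP->; rewrite mxE.
    have zQ : z^t* *m Q != 0 by apply: contraNneq zQv => ->; rewrite mul0mx.
    have [K [zQK /(_ _ zQv) fK]] := kernel_basis zQ; exists K.
    by rewrite !mulmxA zQK zE mul0mx.
  have zEv : z^t* *m E *m v != 0.
    rewrite -mulmxA Ev -scalemxAr scaler_eq0 negb_or e_neq0 /=.
    by apply: contra zz => /eqP->; rewrite mxE.
  have zE : z^t* *m E != 0 by apply: contraNneq zEv => ->; rewrite mul0mx.
  have [K [zEK /(_ _ zEv) fK]] := kernel_basis zE; exists K; split=> //.
    by rewrite mulmxA.
  have : e^* *: (z^t* *m Q *m K) = 0.
    by rewrite scalemxAl prop -scalemxAl zEK scaler0.
  by move/eqP; rewrite scaler_eq0 conjC_eq0 (negPf e_neq0) mulmxA => /eqP.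
have [s ps] := IH K.
have unit1 c : c != 0 -> ((c * (z^t* *m z) 0 0)^-1 *: z^t*) *m (c *: z) = 1%:M.
  move=> c0; have := mx11_scalar (z^t* *m z); move: zz => /[swap].
  move: (_ 0 0) => t zt t0; rewrite -scalemxAl -scalemxAr scalerA zt scale_scalar_mx.
  by rewrite -mulrA mulVf ?mulf_neq0.
have scsub c : ((c *: z)^T <= E^T + Q^T)%MS.
  by rewrite linearZ /= scalemx_sub.
have [e0|e_neq0] := eqVneq e 0.
  have q0 : q != 0 by case: eq0; rewrite // e0 eqxx.
  exists (InfBlock 1 :: s).
  apply: (@partial_form_cons _ (InfBlock 1) s n m.+1 m E Q v K (q *: z)
     ((q * (z^t* *m z) 0 0)^-1 *: z^t*)) => //.
  - rewrite Ev e0 scale0r.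
    by apply/matrixP=> i j; rewrite !mxE big1 // => l _; rewrite !mxE mul0rn !ord1 addr0 mulr0.
  - by rewrite mulmx1.
  - by apply: unit1.
  - by rewrite -scalemxAl EK scaler0.
  - by rewrite -scalemxAl QK scaler0.
exists (JordanBlock (q / e) 1 :: s).
apply: (@partial_form_cons _ (JordanBlock (q / e) 1) s n m.+1 m E Q v K (e *: z)
   ((e * (z^t* *m z) 0 0)^-1 *: z^t*)) => //.
- by rewrite mulmx1.
- have -> : block_A (JordanBlock (q / e) 1) = (q / e)%:M.
    by apply/matrixP=> i j; rewrite !mxE !ord1 addr0.
  by rewrite mul_mx_scalar scalerA divfK.
- by apply: unit1.
- by rewrite -scalemxAl EK scaler0.
- by rewrite -scalemxAl QK scaler0.
Qed.

Lemma bidiagonal_injective k r p (M : 'M[C]_(r, p)) c d (y : 'M[C]_(k, r)) :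
  (r <= p)%N -> c != 0 ->
  (forall i j, M i j = c *+ (i == j :> nat) + d *+ (i.+1 == j :> nat)) ->
  y *m M = 0 -> y = 0.
Proof.
move=> rp c0 Me yM; apply/matrixP=> i j; rewrite mxE.
move: {2}(val j) (erefl (val j)) => l ej; elim/ltn_ind: l j ej => l IHl j ej.
have := congr1 (fun X : 'M_(k, p) => X i (widen_ord rp j)) yM; rewrite !mxE.
rewrite (bigD1 j) //= big1 => [|h hj]; last first.
  rewrite Me /=; have [hj1|_] := eqVneq h.+1 j.
    by rewrite (IHl h) ?mul0r // -ej /= -hj1.
  by move: hj; rewrite -val_eqE => /negPf->; rewrite !mulr0n addr0 mulr0.
rewrite Me eqxx gtn_eqF //= addr0 addr0 mulr1n => /eqP.
by rewrite mulf_eq0 (negPf c0) orbF => /eqP.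
Qed.

(** For [c != 0], what makes [y (E_b - c A_b) = 0] imply [y A_b = 0]: either
    [E_b - c A_b] is bidiagonal with a nonzero diagonal, or [A_b] has no columns. *)
Definition shift_cancellable (c : C) (b : kblock C) :=
  match b with
  | LeftBlock e => e = 0%N
  | JordanBlock lam _ => 1 - c * lam != 0
  | _ => True
  end.

Lemma blockdiag_shift k c s (y : 'M[C]_(k, form_rows s)) : c != 0 ->
  {in s, forall b, shift_cancellable c b} ->
  y *m (blockdiag (@block_E C) s - c *: blockdiag (@block_A C) s) = 0 ->
  y *m blockdiag (@block_A C) s = 0.
Proof.
move=> c0; elim: s y => [|b s IHs] y hs /=; first by rewrite mulmx0.
rewrite -[y]hsubmxK scale_block_mx opp_block_mx add_block_mx !scaler0 !subr0.
rewrite !mul_row_block_diag -[0 in X in X -> _]row_mx0 => /eq_row_mx[yb ys].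
rewrite IHs ?row_mx0 // => [|b' bs]; last by apply: hs; rewrite inE bs orbT.
have {hs IHs ys} hb := hs b (mem_head _ _).
suff -> : lsubmx y *m block_A b = 0 by rewrite row_mx0.
move: (lsubmx y : 'M_(k, block_rows b)) yb => {}y yb {s}.
case: b hb y yb => [e|e|lam r|r] /= hb y yb.
- rewrite (bidiagonal_injective (leqnSn e) (oner_neq0 C) (d := - c) _ yb) ?mul0mx //.
  by move=> i j; rewrite !mxE mulNrn mulr_natr.
- by subst e; rewrite [LHS]thinmx0.
- rewrite (bidiagonal_injective (leqnn r) hb (d := - c) _ yb) ?mul0mx //.
  move=> i j; rewrite !mxE -val_eqE /=.
  by case: eqP => _; case: eqP => _; rewrite ?mulr1n ?mulr0n /=; ring.
- rewrite mulmx1.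
  apply: (bidiagonal_injective (leqnn r) (c := - c) (d := 1) _ _ yb); rewrite ?oppr_eq0 //.
  move=> i j; rewrite !mxE -val_eqE /=.
  by case: eqP => _; case: eqP => _; rewrite ?mulr1n ?mulr0n /=; ring.
Qed.

(** The condition on the left minimal indices is about a Kronecker form of
    [(E, Q)], so that the form has to be exhibited first.  In it, the shift is
    harmless at every eigenvalue because [E - i Q] kills no vector that [E] does
    not kill. *)
Lemma lagrangian_shift_image n m (E Q : 'M[C]_(n, m)) :
  E^t* *m Q = Q^t* *m E -> (forall eta, left_minimal_index E Q eta -> eta = 0%N) ->
  forall v : 'cV[C]_m, exists a : 'cV[C]_m, (E - 'i *: Q) *m a = Q *m v.
Proof.
move=> sym left0 v.
have form : is_kronecker_form E Q (kronecker_form E Q).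
  have [s /partial_form_complete[k fs]] := lagrangian_partial_form sym.
  rewrite /kronecker_form; case: xgetP => [s' _ //|] /(_ _ fs).
  by [].
suff QG : (Q^T <= (E - 'i *: Q)^T)%MS.
  have /submxP[w /(congr1 trmx)] := QG; rewrite trmx_mul !trmxK => Qw.
  by exists (w^T *m v); rewrite mulmxA -Qw.
rewrite submxE; set N := cokermx _.
have NG : N^T *m (E - 'i *: Q) = 0.
  by apply: trmx_inj; rewrite trmx_mul trmxK mulmx_coker trmx0.
suff NQ : N^T *m Q = 0 by rewrite -[Q^T *m N]trmxK trmx_mul trmxK NQ trmx0.
have hs : {in kronecker_form E Q, forall b, shift_cancellable 'i b}.
  move=> b bs; have [okb sb] := kronecker_block bs.
  case: b bs okb sb => [e|e|lam r|r] bs okb sb //=; first exact: left0.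
  have [x [Qx Ex _ _]] := jordan_eigenvector okb sb; apply: contra Ex => /eqP h.
  have [|Ex0 _] := @ker_shift _ _ _ E Q sym _ x; last by rewrite Ex0.
  by rewrite mulmxBl -scalemxAl Qx scalerA -[X in X - _]scale1r -scalerBl h scale0r.
have [_ [en [em [S [T [uS uT SET SAT]]]]]] := form.
pose y := N^T *m castmx (erefl, en) (invmx S).
have eqE := castmx_solve uS SET; have eqQ := castmx_solve uS SAT.
have uT' : row_free (castmx (erefl m, em) T).
  by clear -uT em; case: _ / em; rewrite castmx_id row_free_unit.
apply: (row_free_inj uT'); rewrite mul0mx -mulmxA eqQ mulmxA.
apply: (blockdiag_shift (neq0Ci C) hs).
rewrite mulmxBr -scalemxAr -!mulmxA -eqE -eqQ.
by rewrite scalemxAr -mulmxBr scalemxAl -mulmxBl mulmxA NG mul0mx.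
Qed.


End LagrangianForm.

(** * Dissipative pencils over the complex numbers *)

Section DissipativePencil.
Variables (R : realType) (n m : nat) (E Q : 'M[R[i]]_(n, m)) (L : 'M[R[i]]_n).
Hypothesis EQ_sym : E^t* *m Q = Q^t* *m E.
Hypothesis EQ_psd : forall x : 'cV_m, 0 <= (x^t* *m (Q^t* *m E) *m x) 0 0.
Hypothesis left0 : forall eta, left_minimal_index E Q eta -> eta = 0%N.
Let D := - 2^-1 *: (L + L^t*).
Hypothesis D_psd : forall x : 'cV_n, 0 <= (x^t* *m D *m x) 0 0.
Let A := L *m Q.

Let split (v : 'cV_m) : E^t* *m (Q *m v) = 0 ->
  exists a, E *m a = 0 /\ A *m a = A *m v.
Proof.
move=> /(isotropic_split EQ_sym (lagrangian_shift_image EQ_sym left0))[a [Ea Qa]].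
by exists a; rewrite -!mulmxA Qa.
Qed.

Lemma eigenvalue_stable lam : finite_eigenvalue E A lam -> complex.Re lam <= 0.
Proof.
move=> [r /kronecker_block[ok sb]].
have [v [Av _ _ nonsing]] := jordan_eigenvector ok sb.
rewrite leNgt; apply/negP => re.
have reC : 0 < 'Re lam by rewrite -complexRe ltcR.
have [a [Ea Aa]] := split (unstable_isotropic EQ_sym EQ_psd D_psd Av reC).
by move: re; rewrite (nonsing a Ea Aa) ltxx.
Qed.

Lemma imaginary_block_size (omega : R) r : omega != 0 -> (0 < r)%N ->
  let b := JordanBlock (0 +i* omega)%C r in
  summand (block_E b) (block_A b) E A -> r = 1%N.
Proof.
move=> omega0 r_gt0 b sb.
have [v [Av _ chain nonsing]] := jordan_eigenvector (r_gt0 : block_ok b) sb.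
apply/eqP; rewrite eqn_leq r_gt0 andbT leqNgt; apply/negP => /chain[w Aw].
have im : (0 +i* omega)%C^* = - (0 +i* omega)%C :> R[i].
  by apply/eqP; rewrite eq_complex /= oppr0 !eqxx.
have [a [Ea Aa]] := split (imaginary_chain_isotropic EQ_sym EQ_psd D_psd Av im Aw).
by have /eqP := nonsing a Ea Aa; rewrite eq_complex /= (negPf omega0) andbF.
Qed.

Lemma imaginary_deflating (omega : R) (U : {vspace 'cV[R[i]]_m}) : omega != 0 ->
  regular_deflating_subspace E A (0 +i* omega)%C U ->
  {in U, forall v, D *m (Q *m v) = 0}.
Proof.
move=> omega0 dU v vU.
have Av := deflating_eigenvectors dU (fun r r0 => imaginary_block_size omega0 r0) vU.
apply: (proj1 (imaginary_lossless EQ_sym D_psd Av _)).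
by apply/eqP; rewrite eq_complex /= oppr0 !eqxx.
Qed.

Lemma chain_closes (x0 x1 x2 : 'cV_m) :
  E *m x0 = 0 -> E *m x1 = A *m x0 -> E *m x2 = A *m x1 ->
  exists b, E *m b = E *m x1 /\ A *m b = 0.
Proof.
move=> h0 h1 h2.
have image := lagrangian_shift_image EQ_sym left0.
have [b [Qb Eb]] := infinite_chain_closes EQ_sym image EQ_psd D_psd h0 h1 h2.
by exists b; rewrite -mulmxA Qb mulmx0.
Qed.

Lemma index_le2 : (pencil_index E A <= 2)%N.
Proof.
rewrite /pencil_index; apply/bigmax_leqP_seq => -[e|e|lam r|r] // bs _.
rewrite leqNgt; apply/negP => r2; have [_ sb] := kronecker_block bs.
have [x0 [x1 [x2 [h0 h1 h2 nonsing]]]] := infinite_chain r2 sb.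
have [b [Eb Ab]] := chain_closes h0 h1 h2.
by have := nonsing b Eb; rewrite Ab eqxx.
Qed.

Lemma right_minimal_index_le1 eps : right_minimal_index E A eps -> (eps <= 1)%N.
Proof.
move=> bs; rewrite leqNgt; apply/negP => e1; have [_ sb] := kronecker_block bs.
have [x0 [x1 [x2 [h0 h1 h2 nonsing]]]] := right_chain e1 sb.
have [b [Eb Ab]] := chain_closes h0 h1 h2.
by have := nonsing b Eb; rewrite Ab eqxx.
Qed.

End DissipativePencil.

Section RegularDissipativePencil.
Variables (R : realType) (n m : nat) (E Q : 'M[R[i]]_(n, m)) (L : 'M[R[i]]_n).
Hypothesis EQ_sym : E^t* *m Q = Q^t* *m E.
Hypothesis EQ_psd : forall x : 'cV_m, 0 <= (x^t* *m (Q^t* *m E) *m x) 0 0.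
Let D := - 2^-1 *: (L + L^t*).
Hypothesis D_psd : forall x : 'cV_n, 0 <= (x^t* *m D *m x) 0 0.

Lemma left_minimal_index_eq0 : regular_pencil E Q ->
  forall eta, left_minimal_index E (L *m Q) eta -> eta = 0%N.
Proof.
move=> reg eta /kronecker_block[_ sb]; apply/eqP; rewrite -leqn0 leqNgt.
apply/negP => eta0; have [y [w [p [yE wE pE yA]]]] := left_chain eta0 sb.
have [mu [nm inj _]] := regular_pencil_value reg; subst m.
have uG : E - 'i *: Q \in unitmx.
  rewrite -unitmx_tr -row_free_unit; apply/row_free_trP => c.
  move=> /(ker_shift EQ_sym)[Ec Qc]; apply: inj.
  by rewrite mulmxBl -scalemxAl Ec Qc scaler0 subr0.
have adj k (x : 'rV[R[i]]_n) (M : 'M[R[i]]_(n, k)) : M^t* *m x^t* = (x *m M)^t*.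
  by rewrite trmxC_mul.
have := left_chain_trivial EQ_sym uG EQ_psd D_psd (y := y^t*) (w := w^t*) (p := p^t*).
rewrite !adj yE wE pE trmxC0 => /(_ erefl erefl erefl)/(congr1 (fun M => M^t*)).
by rewrite trmxCK trmxC0 => /eqP; rewrite (negPf yA).
Qed.

End RegularDissipativePencil.

(** * The real and complex ground fields *)

Section Complexification.
Variables (R : realType) (K : ground).

Lemma complexifyM n m p (A : 'M[ground_field R K]_(n, m)) (B : 'M_(m, p)) :
  complexify (A *m B) = complexify A *m complexify B.
Proof.
by case: K A B => A B; [rewrite /complexify !map_mx_id|exact: map_mxM].
Qed.

Lemma complexifyD n m (A B : 'M[ground_field R K]_(n, m)) :
  complexify (A + B) = complexify A + complexify B.
Proof.
by case: K A B => A B; [rewrite /complexify !map_mx_id|exact: map_mxD].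
Qed.

Lemma complexify_half n m (A : 'M[ground_field R K]_(n, m)) :
  complexify (- 2^-1 *: A) = - 2^-1 *: complexify A.
Proof.
case: K A => A; first by rewrite /complexify !map_mx_id.
rewrite [LHS]map_mxZ; congr (_ *: _).
by rewrite rmorphN fmorphV /= rmorph_nat.
Qed.

Lemma complexify_star n m (A : 'M[ground_field R K]_(n, m)) :
  complexify (star A) = (complexify A)^t*.
Proof.
case: K A => A; first by apply/matrixP=> i j; rewrite !mxE.
by apply/matrixP=> i j; rewrite !mxE; apply/eqP; rewrite eq_complex /= oppr0 !eqxx.
Qed.

(** In the real case, [x = a + i b] gives [x^* W x = a^T W a + b^T W b]. *)
Lemma complexify_psd n (W : 'M[ground_field R K]_n) : psd W ->
  forall x : 'cV[R[i]]_n, 0 <= (x^t* *m complexify W *m x) 0 0.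
Proof.
case: K W => W [hW pW] x.
  by rewrite [complexify W]map_mx_id //; apply: pW.
pose a : 'cV[R]_n := map_mx (@complex.Re R) x.
pose b : 'cV[R]_n := map_mx (@complex.Im R) x.
pose f := map_mx (real_complex R).
have -> : x = f _ _ a + 'i *: f _ _ b.
  by apply/matrixP=> i j; rewrite !mxE -complexiE [LHS]complexE.
have adj (c : 'cV[R]_n) : (f _ _ c)^t* = f _ _ c^T.
  by apply/matrixP=> i j; rewrite !mxE; apply/eqP; rewrite eq_complex /= oppr0 !eqxx.
have sym : b^T *m W *m a = a^T *m W *m b.
  have WT : W^T = W by rewrite -[RHS]hW /star /= map_mx_id.
  have tr1 (M : 'M[R]_1) : M^T = M by apply/matrixP=> i j; rewrite !ord1 mxE.
  by rewrite -[LHS]tr1 !trmx_mul trmxK WT mulmxA.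
have ge0 (c : 'cV_n) : 0 <= (c^T *m W *m c) 0 0.
  by have := pW c; rewrite [star c]map_mx_id.
rewrite trmxCD trmxCZ conjCi !adj -[complexify W]/(f _ _ W) !mulmxDl !mulmxDr.
rewrite -!scalemxAl -!scalemxAr -!map_mxM sym scalerA.
rewrite mulNr mulCii opprK scale1r scaleNr addrA addrK -map_mxD mxE lecR mxE.
by rewrite addr_ge0.
Qed.

End Complexification.

Local Open Scope complex_scope.

Theorem theorem21 (R : realType) (K : ground) (n m : nat)
    (E Q : 'M[ground_field R K]_(n, m)) (L : 'M[ground_field R K]_n)
    (hEQ : star E *m Q = star Q *m E)
    (hpsd : psd (star Q *m E))
    (hleft : forall eta : nat,
       left_minimal_index (complexify E) (complexify Q) eta -> eta = 0%N)
    (hL : psd (- 2^-1 *: (L + star L))) :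
  let D := - 2^-1 *: (L + star L) in
  let PE := complexify E in
  let PA := complexify (L *m Q) in
  (forall lam : R[i], finite_eigenvalue PE PA lam -> complex.Re lam <= 0)
  /\
  (forall omega : R, omega != 0 ->
     finite_eigenvalue PE PA (0 +i* omega) ->
     semisimple_eigenvalue PE PA (0 +i* omega)
     /\
     forall (k : nat) (V : 'M[R[i]]_(m, k)) (U : {vspace 'cV[R[i]]_m}),
       regular_deflating_subspace PE PA (0 +i* omega) U ->
       basis_of U (columns V) ->
       complexify (D *m Q) *m V = 0)
  /\
  (pencil_index PE PA <= 2)%N
  /\
  (forall eps : nat, right_minimal_index PE PA eps -> (eps <= 1)%N)
  /\
  (regular_pencil (complexify E) (complexify Q) ->
     forall eta : nat, left_minimal_index PE PA eta -> eta = 0%N).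
Proof.
move=> D PE PA.
have PAE : PA = complexify L *m complexify Q by exact: complexifyM.
have sym : PE^t* *m complexify Q = (complexify Q)^t* *m PE.
  by rewrite -!complexify_star -!complexifyM hEQ.
have EQ_psd (x : 'cV[R[i]]_m) :
    0 <= (x^t* *m ((complexify Q)^t* *m PE) *m x) 0 0.
  by rewrite -complexify_star -complexifyM; exact: complexify_psd hpsd x.
have DE : complexify D = - 2^-1 *: (complexify L + (complexify L)^t*).
  by rewrite complexify_half complexifyD complexify_star.
have D_psd (x : 'cV[R[i]]_n) :
    0 <= (x^t* *m (- 2^-1 *: (complexify L + (complexify L)^t*)) *m x) 0 0.
  by rewrite -DE; exact: complexify_psd hL x.
rewrite PAE; split; [|split; [|split; [|split]]].
- by move=> lam; apply: eigenvalue_stable.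
- move=> omega omega0 _; split=> [r bs|k V U dU bV].
    have [ok sb] := kronecker_block bs.
    exact: (@imaginary_block_size _ _ _ _ _ _ sym EQ_psd hleft D_psd _ _ omega0 ok sb).
  rewrite complexifyM DE; apply/matrixP=> i j.
  have := imaginary_deflating sym EQ_psd hleft D_psd omega0 dU (x := col j V).
  rewrite -(span_basis bV) memv_span => [/(_ isT)|].
    rewrite colE !mulmxA -colE => /matrixP/(_ i 0).
    by rewrite [LHS]mxE [RHS]mxE => ->; rewrite mxE.
  by apply/tnthP; exists j; rewrite tnth_mktuple.
- exact: index_le2 sym EQ_psd hleft D_psd.
- exact: right_minimal_index_le1 sym EQ_psd hleft D_psd.
- exact: left_minimal_index_eq0 sym EQ_psd D_psd.
Qed.
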